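(* Let $d\ge2$, $0<a<\pi/2$ and $\varepsilon\in(0,1]$. Let $c(a,d)$ be a constant with $c(a,d)\ge(2\pi)^{-2d}a^{-1}(\min\{a,\frac\pi2-a\})^{d-1}$ such that $\widetilde U_{\mathsf p}(K)\ge(1+c(a,d)\,t^{(d+1)/2})\,\widetilde U_{\mathsf p}(B_s(\mathsf p,a))$ for all $t\in(0,1]$ and all $K\in\overline{\mathcal{K}}^d_{\mathsf p}$ with $r_{\mathsf p}(K)\ge a$ and $\vartheta_{\mathsf p}(K)\ge t$. Then there are constants $c_{12}>0$, depending on $a,d,\varepsilon$, and $c_{13}$ with $$c_{13}\ge\tfrac12\,c(a,d)\,\sigma_d^\circ(B_s(\mathsf p,2a))\ge\pi^{-4d}a^{d-1}\left(\min\left\{a,\tfrac\pi2-a\right\}\right)^{d-1},$$ such that for every $\gamma_s\in(0,\infty)$, if $X$ is an isotropic Poisson process on $\mathbb{S}^d$ with intensity $\gamma_s$, the typical cell $Z_V$ of the induced spherical Poisson--Voronoi tessellation satisfies $$\mathbb{P}\left(\vartheta_{\mathsf p}(Z_V)\ge\varepsilon\mid r_{\mathsf p}(Z_V)\ge a\right)\le c_{12}\exp\left(-c_{13}\,\varepsilon^{\frac{d+1}{2}}\,\gamma_s\right).$$ Moreover, $$\lim_{\gamma_s\to\infty}\gamma_s^{-1}\ln\mathbb{P}(r_{\mathsf p}(Z_V)\ge a)=-\sigma_d^\circ(B_s(\mathsf p,2a)).$$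
   Context: $\mathbb{S}^d$ is the unit sphere in $\mathbb{R}^{d+1}$ ($d\ge2$) with geodesic distance $d_s$; $\sigma_d^\circ$ is its normalized (probability) spherical Lebesgue measure; $B_s(x,r)$ is the closed geodesic ball; $\mathsf p\in\mathbb{S}^d$ is a fixed point. A spherically convex body is the intersection of $\mathbb{S}^d$ with a closed convex cone in $\mathbb{R}^{d+1}$ that is not a linear subspace; $\overline{\mathcal{K}}^d_{\mathsf p}$ is the set of spherically convex bodies $K$ with $\mathsf p\in K\subset B_s(\mathsf p,\pi/2)$. For $K\in\overline{\mathcal{K}}^d_{\mathsf p}$, $\widetilde U_{\mathsf p}(K)=\int_{\mathbb{S}^d}\mathbf 1\{(x-\mathsf p)^\perp\cap K\ne\emptyset\}\,\sigma_d^\circ(dx)$. For closed $K\ni\mathsf p$ put $r_{\mathsf p}(K)=\max\{r\ge0:B_s(\mathsf p,r)\subset K\}$, $R_{\mathsf p}(K)=\min\{r\ge0:K\subset B_s(\mathsf p,r)\}$; for $K\in\overline{\mathcal{K}}^d_{\mathsf p}$ put $\vartheta_{\mathsf p}(K)=R_{\mathsf p}(K)-r_{\mathsf p}(K)$. Convention: the event $\{\vartheta_{\mathsf p}(Z_V)\ge\varepsilon\}$ is understood as $\{Z_V\in\overline{\mathcal{K}}^d_{\mathsf p},\ \vartheta_{\mathsf p}(Z_V)\ge\varepsilon\}$. (A constant $c(a,d)$ as in the claim exists.) An isotropic Poisson process $X$ with intensity $\gamma_s$ is a Poisson process on $\mathbb{S}^d$ with intensity measure $\gamma_s\sigma_d^\circ$.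 For finite $A\subset\mathbb{S}^d$ and $x\in A$, the Voronoi cell is $C(x,A)=\{y\in\mathbb{S}^d:d_s(y,x)\le d_s(y,z)\text{ for all }z\in A\}$. The typical cell $Z_V$ is a random closed set with distribution $$\mathbb{P}(Z_V\in\cdot)=\frac1{\gamma_s}\mathbb{E}\int_{\mathbb{S}^d}\int_{\mathrm{SO}(d+1)}\mathbf 1\{\varphi^{-1}C(x,X)\in\cdot\}\,\overline\kappa(x,d\varphi)\,X(dx),$$ where $\overline\kappa$ is any probability kernel from $\mathbb{S}^d$ to $\mathrm{SO}(d+1)$ such that $\overline\kappa(x,\cdot)$ is concentrated on $\{\varphi:\varphi\mathsf p=x\}$ for almost every $x$ (the distribution does not depend on the choice of $\overline\kappa$). *)

(* Defs.v *)
From HB Require Import structures.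
From mathcomp Require Import all_boot all_order all_algebra.
From mathcomp Require Import all_classical all_reals all_analysis.
From mathcomp Require Import finmap measurable_realfun.

Set Implicit Arguments.
Unset Strict Implicit.
Unset Printing Implicit Defensive.
Import Order.TTheory GRing.Theory Num.Theory.
Import numFieldTopology.Exports numFieldNormedType.Exports.

Local Open Scope classical_set_scope.
Local Open Scope ring_scope.

(** Points of R^n are column vectors.  Matrix spaces carry the product
    sigma-algebra, i.e. the one generated by the coordinate maps (as the
    library does for tuples); over R it is the Borel sigma-algebra. *)
Section matrix_measurable.
Variables (R : realType) (m n : nat).

Definition mx_cylinders : set (set 'M[R]_(m, n)) :=
  [set A | exists i j (B : set (measurableTypeR R)),
    measurable B /\ A = (fun M : 'M[R]_(m, n) => M i j) @^-1` B].

Let mx_measurable0 : <<s mx_cylinders >> set0.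
Proof. exact: sigma_algebra0. Qed.

Let mx_measurableC A :
  <<s mx_cylinders >> A -> <<s mx_cylinders >> (~` A).
Proof. exact: sigma_algebraC. Qed.

Let mx_measurable_bigcup (F : (set 'M[R]_(m, n))^nat) :
  (forall i, <<s mx_cylinders >> (F i)) ->
  <<s mx_cylinders >> (\bigcup_i F i).
Proof. exact: sigma_algebra_bigcup. Qed.

HB.instance Definition _ := @isMeasurable.Build default_measure_display
  'M[R]_(m, n) <<s mx_cylinders >>
  mx_measurable0 mx_measurableC mx_measurable_bigcup.

Lemma measurable_coord (i : 'I_m) (j : 'I_n) :
  measurable_fun [set: 'M[R]_(m, n)]
    ((fun M => M i j) : _ -> measurableTypeR R).
Proof.
move=> _ B mB; rewrite setTI; apply: sub_sigma_algebra.
by exists i, j, B.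
Qed.

Lemma measurable_fun_mx d (T : measurableType d) (f : T -> 'M[R]_(m, n)) :
  (forall i j, measurable_fun [set: T]
     ((fun t => f t i j) : _ -> measurableTypeR R)) ->
  measurable_fun [set: T] f.
Proof.
move=> mf; apply: (@measurability _ _ _ _ _ _ mx_cylinders) => //.
move=> _ [A [i [j [B [mB ->]]]] <-].
exact: mf.
Qed.

End matrix_measurable.

Section lebesgue_cV.
Variable R : realType.

Definition cons_cV n (z : measurableTypeR R * 'cV[R]_n) : 'cV[R]_n.+1 :=
  col_mx (const_mx z.1 : 'cV[R]_1) z.2.

Lemma measurable_cons_cV n : measurable_fun [set: _] (@cons_cV n).
Proof.
apply: measurable_fun_mx => i j; rewrite /cons_cV.
rewrite (_ : (fun _ => _) = fun t : measurableTypeR R * 'cV[R]_n =>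
    match fintype.split (i : 'I_(1 + n)) with
    | inl _ => t.1
    | inr k => t.2 k j
    end); last first.
  apply/funext => t; rewrite [LHS]mxE.
  by case: splitP => k _; rewrite ?mxE.
case: (fintype.split _) => k; first exact: measurable_fst.
by apply: (measurableT_comp (measurable_coord k j)); exact: measurable_snd.
Qed.

Definition uncons_cV n (x : 'cV[R]_n.+1) : measurableTypeR R * 'cV[R]_n :=
  (x ord0 ord0, dsubmx (x : 'cV[R]_(1 + n))).

Lemma cons_cVK n : cancel (@cons_cV n) (@uncons_cV n).
Proof.
move=> [t y]; rewrite /uncons_cV /cons_cV /=; congr pair.
  rewrite (_ : ord0 = lshift n ord0 :> 'I_(1 + n)); last exact/val_inj.
  by rewrite [LHS](col_mxEu (const_mx t : 'cV_1) y) mxE.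
exact: col_mxKd.
Qed.

Lemma measurable_uncons_cV n : measurable_fun [set: _] (@uncons_cV n).
Proof.
apply/measurable_fun_pairP; split; first exact: measurable_coord.
apply: measurable_fun_mx => i j.
rewrite (_ : (fun _ => _) =
    fun x : 'cV[R]_n.+1 => x (rshift 1 i : 'I_(1 + n)) j).
  exact: measurable_coord.
by apply/funext => x /=; rewrite mxE.
Qed.

Section step.
Variables (n : nat) (mu : {sigma_finite_measure set 'cV[R]_n -> \bar R}).
Local Open Scope ereal_scope.

Definition lebesgue_cons : set 'cV[R]_n.+1 -> \bar R :=
  pushforward (@lebesgue_measure R \x mu) (@cons_cV n).

Let mpre (A : set 'cV[R]_n.+1) :
  measurable A -> measurable (@cons_cV n @^-1` A).
Proof. by move=> mA; rewrite -[X in measurable X]setTI; exact: measurable_cons_cV. Qed.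

Let lebesgue_cons0 : lebesgue_cons set0 = 0.
Proof. by rewrite /lebesgue_cons /pushforward preimage_set0 measure0. Qed.

Let lebesgue_cons_ge0 A : 0 <= lebesgue_cons A.
Proof. by rewrite /lebesgue_cons /pushforward measure_ge0. Qed.

Let lebesgue_cons_sigma_additive : semi_sigma_additive lebesgue_cons.
Proof.
move=> F mF tF mUF; rewrite /lebesgue_cons /pushforward preimage_bigcup.
apply: measure_semi_sigma_additive.
- by move=> k; exact: mpre.
- apply/trivIsetP => i j _ _ ij; rewrite -preimage_setI.
  by move/trivIsetP : tF => ->//; rewrite preimage_set0.
- by rewrite -preimage_bigcup; exact: mpre.
Qed.

HB.instance Definition _ := isMeasure.Build _ _ _ lebesgue_cons
  lebesgue_cons0 lebesgue_cons_ge0 lebesgue_cons_sigma_additive.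

Let lebesgue_cons_sigma_finite : sigma_finite setT lebesgue_cons.
Proof.
have /sigma_finiteP[F [FT ndF Foo]] := sigma_finiteT (@lebesgue_measure R).
have /sigma_finiteP[G [GT ndG Goo]] := sigma_finiteT mu.
exists (fun k => @uncons_cV n @^-1` (F k `*` G k)).
  rewrite -preimage_bigcup (_ : \bigcup_k _ = setT) ?preimage_setT//.
  apply/seteqP; split => // -[x y] _.
  have [i _ Fx] : (\bigcup_i F i) x by case/seteqP: FT => + _; exact.
  have [j _ Gy] : (\bigcup_j G j) y by case/seteqP: GT => + _; exact.
  exists (maxn i j) => //; split => /=.
    by apply: subsetPset Fx; apply: ndF; exact: leq_maxl.
  by apply: subsetPset Gy; apply: ndG; exact: leq_maxr.
move=> k; have [mF Fk] := Foo k; have [mG Gk] := Goo k; split.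
  rewrite -[X in measurable X]setTI; apply: measurable_uncons_cV => //.
  exact: measurableX.
rewrite /lebesgue_cons /pushforward -comp_preimage.
rewrite (_ : _ \o _ = id) ?preimage_id; last first.
  by apply/funext => z /=; rewrite cons_cVK.
by rewrite product_measure1E// lte_mul_pinfty// ge0_fin_numE.
Qed.

HB.instance Definition _ := Measure_isSigmaFinite.Build _ _ _ lebesgue_cons
  lebesgue_cons_sigma_finite.

End step.

Fixpoint lebesgue_cV n : {sigma_finite_measure set 'cV[R]_n -> \bar R} :=
  if n is n'.+1 then lebesgue_cons (lebesgue_cV n') else \d_(0 : 'cV[R]_0).

End lebesgue_cV.

Section sphere.
Variables (R : realType) (d : nat).
Local Notation V := ('cV[R]_d.+1).
Implicit Types (x y p : V) (A K : set V).

(** The library's norm on matrices is the sup norm, hence [dot]. *)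
Definition dot x y : R := \sum_i x i 0 * y i 0.

Definition sphere : set V := [set x | dot x x = 1].

Definition geo_dist x y : R := acos (dot x y).

Definition geo_ball x (r : R) : set V :=
  [set y | sphere y /\ geo_dist x y <= r].

Definition direction x : V := (Num.sqrt (dot x x))^-1 *: x.

Definition punctured_ball : set V := [set x | 0 < dot x x <= 1].

(** The Lebesgue measure of [{t *: x | 0 < t <= 1, x \in A, x \in sphere}],
    which is the spherical Lebesgue measure of [A] up to the factor [d + 1]. *)
Definition cone_measure A : \bar R :=
  lebesgue_cV R d.+1 (punctured_ball `&` direction @^-1` A).

Lemma measurable_dot : measurable_fun [set: V] (fun x => dot x x).
Proof.
apply: measurable_sum => i; apply: measurable_funM; exact: measurable_coord.
Qed.

Lemma measurable_direction : measurable_fun [set: V] direction.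
Proof.
apply: measurable_fun_mx => i j; rewrite /direction.
rewrite (_ : (fun _ => _) =
    (fun x : V => (Num.sqrt (dot x x)) `^ (-1) * x i j)); last first.
  by apply/funext => x; rewrite mxE powR_inv1// sqrtr_ge0.
apply: measurable_funM; last exact: measurable_coord.
apply: (@measurableT_comp _ _ _ _ _ _ (@powR R ^~ (-1))) => //.
apply: (@measurableT_comp _ _ _ _ _ _ (@Num.sqrt R) _ (fun x => dot x x));
  last exact: measurable_dot.
by apply: continuous_measurable_fun; exact: sqrt_continuous.
Qed.

Lemma measurable_punctured_ball : measurable punctured_ball.
Proof.
rewrite (_ : punctured_ball = (fun x => dot x x) @^-1` `]0, 1]%classic).
  by rewrite -[X in measurable X]setTI; exact: measurable_dot.
by apply/seteqP; split => x /=; rewrite in_itv.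
Qed.

Let mcone A : measurable A ->
  measurable (punctured_ball `&` direction @^-1` A).
Proof.
move=> mA; apply: measurableI; first exact: measurable_punctured_ball.
by rewrite -[X in measurable X]setTI; exact: measurable_direction.
Qed.

Local Open Scope ereal_scope.

Let cone_measure0 : cone_measure set0 = 0.
Proof. by rewrite /cone_measure preimage_set0 setI0 measure0. Qed.

Let cone_measure_ge0 A : 0 <= cone_measure A.
Proof. exact: measure_ge0. Qed.

Let cone_measure_sigma_additive : semi_sigma_additive cone_measure.
Proof.
move=> F mF tF mUF; rewrite /cone_measure preimage_bigcup setI_bigcupr.
apply: measure_semi_sigma_additive.
- by move=> k; exact: mcone.
- apply/trivIsetP => i j _ _ ij; rewrite setIACA setIid -preimage_setI.
  by move/trivIsetP : tF => ->//; rewrite preimage_set0 setI0.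
- by rewrite -setI_bigcupr -preimage_bigcup; exact: mcone.
Qed.

HB.instance Definition _ := isMeasure.Build _ _ _ cone_measure
  cone_measure0 cone_measure_ge0 cone_measure_sigma_additive.

End sphere.
Arguments sphere {R d}.

(** The fallback [\d_0] of [mnormalize] is not used, as the unit ball has
    positive finite volume. *)
Definition sigma_circ (R : realType) (d : nat) : probability 'cV[R]_d.+1 R :=
  mnormalize (@cone_measure R d) (dirac (0 : 'cV[R]_d.+1)).

Section bodies.
Variables (R : realType) (d : nat).
Local Notation V := ('cV[R]_d.+1).
Implicit Types (x y p : V) (A K : set V).

Definition closed_convex_cone (C : set V) :=
  [/\ C !=set0, closed C,
      forall (t : R) x, 0 <= t -> C x -> C (t *: x) &
      convex_set (C : set (convex_lmodType V))].

Definition linear_subspace (C : set V) :=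
  exists U : {vspace V}, C = [set x | x \in U].

Definition sph_convex_body K :=
  exists C : set V,
    [/\ closed_convex_cone C, ~ linear_subspace C & K = sphere `&` C].

Definition bodies_at p K :=
  [/\ sph_convex_body K, K p & K `<=` geo_ball p (pi / 2)].

Definition orth x : set V := [set y | dot x y = 0].

Definition Utilde p K : \bar R :=
  \int[sigma_circ R d]_(x in sphere)
    (\1_[set z | (orth (z - p) `&` K) !=set0] x)%:E.

(** Radii of geodesic balls range in [0, pi]; without this bound the maximum
    defining [inradius p sphere] would not exist. *)
Definition inradius p K : R :=
  sup [set r | 0 <= r <= pi /\ geo_ball p r `<=` K].

Definition circumradius p K : R :=
  inf [set r | 0 <= r /\ K `<=` geo_ball p r].

Definition vartheta p K : R := circumradius p K - inradius p K.

End bodies.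

Section poisson_voronoi.
Variables (R : realType) (d : nat).
Local Notation V := ('cV[R]_d.+1).
Local Notation M := ('M[R]_d.+1).

Definition voronoi_cell (x : V) (A : set V) : set V :=
  [set y | sphere y /\ forall z, A z -> geo_dist y x <= geo_dist y z].

Section process.
Context (dO : measure_display) (Om : measurableType dO).
Variables (P : probability Om R) (X : Om -> set V).

Definition count (B : set V) (w : Om) : nat := #|` fset_set (X w `&` B)|.

(** As usual for a diffuse intensity measure, a Poisson process is a simple
    point process, identified with its (here finite) random support. *)
Record isotropic_poisson (gamma : R) : Prop := IsotropicPoisson {
  poisson_sub : forall w, X w `<=` sphere ;
  poisson_finite : forall w, finite_set (X w) ;
  poisson_measurable : forall B, measurable B ->
    measurable_fun [set: Om] (count B) ;
  poisson_law : forall B (k : nat), measurable B ->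
    let l := gamma * fine (sigma_circ R d B) in
    P [set w | count B w = k] = (l ^+ k / k`!%:R * expR (- l))%:E ;
  poisson_independent : forall n (B : 'I_n -> set V) (D : 'I_n -> set nat),
    (forall i, measurable (B i)) -> trivIset [set: 'I_n] B ->
    P (\bigcap_i [set w | D i (count (B i) w)]) =
      (\prod_(i < n) P [set w | D i (count (B i) w)])%E }.

Definition SO : set M := [set phi | phi *m phi^T = 1%:M /\ \det phi = 1].

(** A kernel from the sphere to [SO] is presented as (an arbitrary extension
    to) a kernel between the ambient matrix spaces; only its values on the
    sphere matter. *)
Definition rotation_kernel (p : V) (kappa : R.-pker V ~> M) :=
  (forall x, sphere x -> kappa x (~` SO) = 0%E) /\
  {ae sigma_circ R d, forall x, kappa x (~` [set phi | phi *m p = x]) = 0%E}.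

Definition typical_cell_prob (gamma : R) (kappa : R.-pker V ~> M)
    (E : set (set V)) : \bar R :=
  (gamma^-1%:E * \int[P]_w \sum_(x \in X w) \int[kappa x]_phi
     (\1_[set psi | E ([set invmx psi *m y | y in voronoi_cell x (X w)])]
        phi)%:E)%E.

End process.

Definition typical_cell_law (p : V) (gamma : R) (Q : set (set V) -> \bar R) :=
  exists (dO : measure_display) (Om : measurableType dO)
    (P : probability Om R) (X : Om -> set V) (kappa : R.-pker V ~> M),
    [/\ isotropic_poisson P X gamma, rotation_kernel p kappa &
        Q = typical_cell_prob P X gamma kappa].

Definition cond_prob (Q : set (set V) -> \bar R) (E F : set (set V)) : R :=
  fine (Q (E `&` F)) / fine (Q F).

End poisson_voronoi.

(* Main.v *)
(** Fix a nucleus [x] of the Poisson process [X].  Its cell contains [B(x, a)]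
    exactly when [X] has no other point at distance less than [2 a] from [x].
    Instead of Mecke's formula we cut the sphere into finitely many small
    pieces [W_i]: up to a slight change of radius, the number of such nuclei is
    the number of [i] such that [X] has exactly one point in [W_i] and none in
    the rest of a ball of radius [2 a] around [W_i], whose expectation is
    explicit by independence.  As the mesh tends to zero this gives
    [P (r >= a) = exp (- gamma rho)] for every [gamma], where [rho] is the
    measure of [B(p, 2 a)].

    A cell with inradius at least [a] and [vartheta >= eps] also contains a
    point [y] at distance [t] from [x], for every [t < a + eps]; then [X] avoids
    the open ball of radius [t] around [y] as well.  A finite net for [y] bounds
    the numerator by [C exp (- gamma (sigma (B(p, 2 a) U B(y0, t)) - eta))]: by
    rotation invariance the measure of the union depends only on the distance
    [t] of [p] and [y0].  The stability hypothesis is needed for one body only,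
    the spherical hull of [B(p, a)] and [y0], whose hitting set is contained in
    the same union.  The factor 1/2 in [c13] absorbs [eta] and the passage from
    [eps] to [t - a]. *)

Require Import Defs.
From HB Require Import structures.
From mathcomp Require Import all_boot all_order all_algebra.
From mathcomp Require Import all_classical all_reals all_analysis.
From mathcomp Require Import finmap measurable_realfun.
From mathcomp Require Import ring lra.
Set Implicit Arguments.
Unset Strict Implicit.
Unset Printing Implicit Defensive.
Import Order.TTheory GRing.Theory Num.Theory.
Import numFieldTopology.Exports numFieldNormedType.Exports.
Local Open Scope classical_set_scope.
Local Open Scope ring_scope.

(** * Lebesgue measure on column vectors *)

(** Two obstacles shape the proof. Neither the set of rotations in [typical_cell_prob] nor the
    hitting set in [Utilde] is known to be measurable, so every estimate compares them with
    measurable sets, relying on the monotonicity of the integral of nonnegative functions. And the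
    rotation invariance of [sigma_circ] has to be derived for a Lebesgue measure built coordinate by
    coordinate. Reflections suffice for it: two of them match any two pairs of points with equal
    inner products, while a rotation [psi] only carries a cell from [x] to [p] and enters through
    the inner products that it preserves.

    The explicit bound on [c13] asks for an explicit bound on [rho]: dividing the claimed constant
    by half the lower bound on [c] leaves [2 * (4 * a / pi ^+ 2) ^+ d]. This is the reason for the
    volume estimates for caps. *)

Lemma preimageT_measurable d1 d2 (T1 : measurableType d1)
    (T2 : measurableType d2) (f : T1 -> T2) (A : set T2) :
  measurable_fun setT f -> measurable A -> measurable (f @^-1` A).
Proof. by move=> mf mA; rewrite -[X in measurable X]setTI; exact: mf. Qed.

(** The generated instance is applied by hand in order to pass [mf], on which the measure structure
    of a pushforward depends. *)
Definition image_measure d1 d2 (T1 : measurableType d1)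
    (T2 : measurableType d2) (R : realType) (m : {measure set T1 -> \bar R})
    (f : T1 -> T2) (mf : measurable_fun setT f) : {measure set T2 -> \bar R} :=
  measure_function_pushforward__canonical__measure_function_Measure m mf.

Section affine_invariance.
Variable R : realType.
Local Notation leb := (@lebesgue_measure R).

Lemma measurable_affine (s h : R) :
  measurable_fun setT ((fun x => s * x + h) : measurableTypeR R -> measurableTypeR R).
Proof. by apply: measurable_funD => //; apply: measurable_funM. Qed.

(** Both sides are measures in [A], so it is enough to compare them on half-open intervals. *)
Lemma lebesgue_measure_affine (s h : R) (A : set (measurableTypeR R)) : 0 < s ->
  measurable A ->
  (s%:E * leb ((fun x => s * x + h)%R @^-1` A) = leb A)%E.
Proof.
move=> s0 mA.
pose m := mscale (NngNum (ltW s0)) (image_measure leb (measurable_affine s h)).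
apply/esym; rewrite -[RHS]/(m A).
apply: lebesgue_measure_unique mA => _ [[x y]] _ <- /=.
rewrite /m /mscale /image_measure /= /pushforward.
rewrite (_ : _ @^-1` _ = `]((x - h) / s), ((y - h) / s)]%classic); last first.
  apply/seteqP; split => z /=; rewrite !in_itv/= ltr_pdivrMr// ler_pdivlMr//;
  by rewrite ltrBlDr lerBrDr mulrC.
rewrite !lebesgue_measure_itv/= !lte_fin ltr_pM2r ?invr_gt0// ltrD2r.
case: ifPn => xy; last by rewrite mule0.
by rewrite -!EFinD -EFinM; congr EFin; field; rewrite gt_eqF.
Qed.

Lemma measurable_affine_cV n (s : R) (h : 'cV[R]_n) :
  measurable_fun setT ((fun x => s *: x + h) : 'cV[R]_n -> 'cV[R]_n).
Proof.
apply: measurable_fun_mx => i j.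
rewrite (_ : (fun _ => _) = fun t : 'cV[R]_n => s * t i j + h i j); last first.
  by apply/funext => t; rewrite !mxE.
by apply: measurable_funD => //; apply: measurable_funM => //; exact: measurable_coord.
Qed.

Lemma affine_cons_cV n (s : R) (h : 'cV[R]_n.+1) z :
  s *: cons_cV z + h =
  cons_cV (s * z.1 + (uncons_cV h).1, s *: z.2 + (uncons_cV h).2).
Proof.
rewrite /cons_cV /uncons_cV /=; apply/matrixP => i j; rewrite !mxE.
by case: splitP => k ik; rewrite !mxE; congr (_ + _); congr (h _ _);
  apply/val_inj => /=; rewrite ?ik ?ord1.
Qed.

(** Induction on the dimension: the map acts separately on the first coordinate and on the others,
    so rectangles acquire the factors [s] and [s ^+ n], and uniqueness of the product measure
    extends this to all measurable sets. *)
Lemma lebesgue_cV_affine n (s : R) (h : 'cV[R]_n) (A : set 'cV[R]_n) : 0 < s ->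
  measurable A ->
  ((s ^+ n)%:E * lebesgue_cV R n ((fun x => s *: x + h)%R @^-1` A)
   = lebesgue_cV R n A)%E.
Proof.
move=> s0; elim: n h A => [|n IH] h A mA.
  rewrite expr0 mul1e; congr (lebesgue_cV _ _ _).
  by apply/seteqP; split => x /=; rewrite (flatmx0 x) (flatmx0 (_ + _)).
pose f1 (x : measurableTypeR R) : measurableTypeR R := s * x + (uncons_cV h).1.
pose f2 (x : 'cV[R]_n) := s *: x + (uncons_cV h).2.
pose f (z : measurableTypeR R * 'cV[R]_n) := (f1 z.1, f2 z.2).
have mf : measurable_fun setT f.
  apply/measurable_fun_pairP; split.
    exact: (measurableT_comp (@measurable_affine s _) (@measurable_fst _ _ _ _)).
  exact: (measurableT_comp (@measurable_affine_cV n s _) (@measurable_snd _ _ _ _)).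
have s0n : 0 <= s ^+ n.+1 by rewrite exprn_ge0// ltW.
pose m := mscale (NngNum s0n) (image_measure (leb \x lebesgue_cV R n)%E mf).
have mE X : m X =
    ((s ^+ n.+1)%:E * (leb \x lebesgue_cV R n) (f @^-1` X))%E by [].
rewrite [RHS]/= /lebesgue_cons /pushforward.
have mA' : measurable (@cons_cV R n @^-1` A).
  exact: (preimageT_measurable (@measurable_cons_cV R n)).
rewrite (@product_measure_unique _ _ _ _ _ _ _ m)//; last first.
  move=> B C mB mC; rewrite [LHS]mE.
  rewrite (_ : f @^-1` _ = (f1 @^-1` B) `*` (f2 @^-1` C))//.
  rewrite product_measure1E//; last 2 first.
  - exact: (preimageT_measurable (@measurable_affine s _)).
  - exact: (preimageT_measurable (@measurable_affine_cV n s _)).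
  transitivity ((s%:E * leb (f1 @^-1` B)) *
    ((s ^+ n)%:E * lebesgue_cV R n (f2 @^-1` C)))%E.
    by rewrite exprS EFinM muleACA.
  by congr (_ * _)%E; [exact: lebesgue_measure_affine|exact: IH].
rewrite [RHS]mE; congr (_ * _)%E.
rewrite /lebesgue_cons /pushforward; congr ((_ \x _)%E _).
by apply/seteqP; split => z /=; rewrite affine_cons_cV.
Qed.

Lemma lebesgue_cV_translation n (h : 'cV[R]_n) (A : set 'cV[R]_n) :
  measurable A ->
  lebesgue_cV R n ((fun x => x + h) @^-1` A) = lebesgue_cV R n A.
Proof.
move=> mA; rewrite -[RHS](@lebesgue_cV_affine n 1 h)// expr1n mul1e.
by congr (lebesgue_cV _ _ _); apply/seteqP; split => x /=; rewrite scale1r.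
Qed.

Definition box n (a b : R) : set 'cV[R]_n := [set x | forall i, a < x i 0 <= b].
Arguments box : clear implicits.

Lemma measurable_box n a b : measurable (box n a b).
Proof.
rewrite (_ : box n a b = \bigcap_(i in [set: 'I_n])
   ((fun x : 'cV[R]_n => x i 0 : measurableTypeR R) @^-1` `]a, b]%classic)).
  apply: fin_bigcap_measurable => // i _.
  exact: (preimageT_measurable (@measurable_coord _ _ _ _ _)).
by apply/seteqP; split => x /= H i; have := H i; rewrite /= in_itv/=; [move=> + _|apply].
Qed.

Lemma lebesgue_cV_box n a b : a <= b ->
  lebesgue_cV R n (box n a b) = ((b - a) ^+ n)%:E.
Proof.
move=> ab; elim: n => [|n IH].
  by rewrite /= diracE mem_set ?expr0// => -[].
rewrite /= /lebesgue_cons /pushforward.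
rewrite (_ : _ @^-1` _ = `]a, b]%classic `*` box n a b); last first.
  apply/seteqP; split => -[t y] /=; rewrite in_itv/=.
    move=> H; split.
      have := H ord0; rewrite /cons_cV (_ : ord0 = lshift n ord0 :> 'I_(1 + n)); last exact/val_inj.
      by rewrite [X in _ < X <= _](col_mxEu (const_mx t : 'cV_1) y) mxE.
    move=> i; have := H (rshift 1 i : 'I_(1 + n)).
    by rewrite [X in _ < X <= _](col_mxEd (const_mx t : 'cV_1) y).
  move=> [H1 H2] i; rewrite /cons_cV mxE; case: splitP => k _ //.
  by rewrite mxE.
rewrite product_measure1E//; last exact: measurable_box.
transitivity ((b - a)%:E * ((b - a) ^+ n)%:E)%E; last by rewrite exprS EFinM.
congr (_ * _)%E; last exact: IH.
transitivity (leb `]a, b]) => //; rewrite lebesgue_measure_itv/= lte_fin.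
by case: ltgtP ab => // -> _; rewrite subrr.
Qed.

End affine_invariance.
Arguments box {R}.

(** * Inner product and reflections *)

Section dot_theory.
Variables (R : realType) (d : nat).
Local Notation V := ('cV[R]_d.+1).
Implicit Types (x y z v p : V) (k : R).

Lemma dotC x y : dot x y = dot y x.
Proof. by apply: eq_bigr => i _; rewrite mulrC. Qed.

Lemma dotDl x y z : dot (x + y) z = dot x z + dot y z.
Proof. by rewrite -big_split; apply: eq_bigr => i _; rewrite mxE mulrDl. Qed.

Lemma dotZl k x z : dot (k *: x) z = k * dot x z.
Proof. by rewrite mulr_sumr; apply: eq_bigr => i _; rewrite mxE mulrA. Qed.

Lemma dotDr z x y : dot z (x + y) = dot z x + dot z y.
Proof. by rewrite dotC dotDl !(dotC z). Qed.

Lemma dotZr k z x : dot z (k *: x) = k * dot z x.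
Proof. by rewrite dotC dotZl dotC. Qed.

Lemma dotNl x z : dot (- x) z = - dot x z.
Proof. by rewrite -scaleN1r dotZl mulN1r. Qed.

Lemma dotNr z x : dot z (- x) = - dot z x.
Proof. by rewrite dotC dotNl dotC. Qed.

Lemma dotBl x y z : dot (x - y) z = dot x z - dot y z.
Proof. by rewrite dotDl dotNl. Qed.

Lemma dotBr z x y : dot z (x - y) = dot z x - dot z y.
Proof. by rewrite dotDr dotNr. Qed.

Definition dotE := (dotDl, dotDr, dotZl, dotZr, dotNl, dotNr).

Lemma dot_ge0 x : 0 <= dot x x.
Proof. by apply: sumr_ge0 => i _; rewrite -expr2 sqr_ge0. Qed.

Lemma dot_eq0 x : dot x x = 0 -> x = 0.
Proof.
move=> /eqP; rewrite psumr_eq0 => [/allP h|i _]; last by rewrite -expr2 sqr_ge0.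
apply/matrixP => i j; rewrite mxE (ord1 j).
by have := h i (mem_index_enum _); rewrite -expr2 sqrf_eq0 => /eqP.
Qed.

Lemma dot0l x : dot 0 x = 0.
Proof. by rewrite -(scale0r 0) dotZl mul0r. Qed.

Lemma CauchySchwarz x y : dot x y ^+ 2 <= dot x x * dot y y.
Proof.
have [/dot_eq0 ->|y0] := eqVneq (dot y y) 0.
  by rewrite dotC !dot0l mulr0 expr0n.
have {}y0 : 0 < dot y y by rewrite lt_def y0 dot_ge0.
rewrite -subr_ge0 -(pmulr_lge0 _ y0).
have := dot_ge0 (dot y y *: x - dot x y *: y).
by rewrite !dotE (dotC y x); congr (0 <= _); ring.
Qed.

Lemma dot_unit_le1 x y : sphere x -> sphere y -> -1 <= dot x y <= 1.
Proof.
move=> Sx Sy; have := CauchySchwarz x y; rewrite Sx Sy mulr1 => h.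
by apply/andP; split; nra.
Qed.

(** The reflection in the hyperplane orthogonal to [v]. It is the identity for [v = 0], which covers
    the case [x = y] of [refl_swap]. *)
Definition refl v x := x - (2 * dot v x / dot v v) *: v.

Lemma refl_linear v k x y : refl v (k *: x + y) = k *: refl v x + refl v y.
Proof.
by apply/matrixP => i j; rewrite !mxE !dotE; ring.
Qed.

Lemma reflZ v k x : refl v (k *: x) = k *: refl v x.
Proof. by apply/matrixP => i j; rewrite !mxE !dotE; ring. Qed.

Lemma reflK v : involutive (refl v).
Proof.
move=> x; have [/dot_eq0 ->|v0] := eqVneq (dot v v) 0.
  by rewrite /refl !scaler0 !subr0.
by apply/matrixP => i j; rewrite /refl !mxE !dotE; field.
Qed.

Lemma dot_refl v x y : dot (refl v x) (refl v y) = dot x y.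
Proof.
have [/dot_eq0 ->|v0] := eqVneq (dot v v) 0.
  by rewrite /refl !scaler0 !subr0.
by rewrite /refl !dotE (dotC x v); field.
Qed.

Lemma dot_reflC v x y : dot (refl v x) y = dot x (refl v y).
Proof. by rewrite -[in LHS](reflK v y) dot_refl. Qed.

(** For vectors of equal norm, [dot (x - y) (x - y)] is twice [dot (x - y) x], so exactly [x - y] is
    subtracted from [x]. *)
Lemma refl_swap x y : dot x x = dot y y -> refl (x - y) x = y.
Proof.
move=> xy; have [/dot_eq0 /subr0_eq ->|v0] := eqVneq (dot (x - y) (x - y)) 0.
  by rewrite /refl subrr scaler0 subr0.
rewrite /refl (_ : 2 * _ / _ = 1) ?scale1r ?subKr//.
apply/eqP; rewrite -(inj_eq (mulIf v0)) divfK// mul1r; apply/eqP.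
by rewrite !dotE -xy (dotC y x); ring.
Qed.

Lemma refl_orth v x : dot v x = 0 -> refl v x = x.
Proof. by move=> vx; rewrite /refl vx mulr0 mul0r scale0r subr0. Qed.

Lemma measurable_dotl x : measurable_fun setT (dot x : V -> measurableTypeR R).
Proof.
by apply: measurable_sum => i; apply: measurable_funM => //; exact: measurable_coord.
Qed.

Lemma measurable_refl v : measurable_fun setT (refl v).
Proof.
apply: measurable_fun_mx => i j.
rewrite (_ : (fun _ => _) =
    fun x => x i j - 2 * dot v x / dot v v * v i j); last first.
  by apply/funext => x; rewrite !mxE.
apply: measurable_funB; first exact: measurable_coord.
apply: measurable_funM => //; apply: measurable_funM => //.
by apply: measurable_funM => //; exact: measurable_dotl.
Qed.

End dot_theory.

(** * Invariance of the spherical measure under reflections *)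

Section orthogonal_invariance.
Variables (R : realType) (d : nat).
Local Notation V := ('cV[R]_d.+1).
Local Notation mu := (lebesgue_cV R d.+1).
Local Notation pb := (@punctured_ball R d).
Local Open Scope ereal_scope.

Lemma punctured_ball_fin : mu pb < +oo.
Proof.
(* Boxes are open on the left, so the lower corner must lie strictly below -1. *)
apply: (@le_lt_trans _ _ (mu (box d.+1 (-2) 1))).
  apply: le_measure; rewrite ?in_setE.
  - exact: measurable_punctured_ball.
  - exact: measurable_box.
  move=> x /andP[_ x1] i; apply/andP.
  have : (x i ord0 ^+ 2 <= 1)%R.
    apply: (le_trans _ x1); rewrite /dot (bigD1 i)//= -expr2 lerDl.
    by apply: sumr_ge0 => k _; rewrite -expr2 sqr_ge0.
  rewrite -{1}(expr1n _ 2) -real_normK ?num_real// ler_sqr ?nnegrE//.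
  by rewrite ler_norml => /andP[? ?]; split => //; lra.
by rewrite lebesgue_cV_box ?ltry//; lra.
Qed.

Lemma punctured_ball_gt0 : 0 < mu pb.
Proof.
have n0 : (0 < d.+1%:R^-1 :> R)%R by rewrite invr_gt0 ltr0n.
apply: (@lt_le_trans _ _ (mu (box d.+1 0 d.+1%:R^-1))).
  by rewrite lebesgue_cV_box ?ltW// subr0 lte_fin exprn_gt0.
apply: le_measure; rewrite ?in_setE.
- exact: measurable_box.
- exact: measurable_punctured_ball.
move=> x h; apply/andP; split.
  rewrite /dot big_ord_recl ltr_pwDl//.
    by have /andP[h0 _] := h ord0; rewrite mulr_gt0.
  by apply: sumr_ge0 => k _; rewrite -expr2 sqr_ge0.
apply: (@le_trans _ _ (\sum_(i < d.+1) d.+1%:R^-1)%R); last first.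
  by rewrite sumr_const card_ord -[X in (X <= _)%R]mulr_natr mulVf// pnatr_eq0.
apply: ler_sum => i _; have /andP[h0 h1] := h i.
apply: le_trans (_ : _ <= d.+1%:R^-1 * d.+1%:R^-1)%R _.
  by apply: ler_pM => //; exact: ltW.
by rewrite ger_pMr// invf_le1 ?ltr0n// ler1n.
Qed.

Section haar.
Variable nu : {sigma_finite_measure set V -> \bar R}.
Hypothesis nu_translation : forall (h : V) (A : set V), measurable A ->
  nu ((fun x => x + h)%R @^-1` A) = nu A.
Hypothesis nu_gt0 : 0 < nu pb.
Hypothesis nu_fin : nu pb < +oo.
Variable f : V -> V.
Hypothesis mf : measurable_fun setT f.
Hypothesis f_linear : forall (k : R) x y, f (k *: x + y)%R = (k *: f x + f y)%R.
Hypothesis fK : involutive f.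
Hypothesis f_dot : forall x, dot (f x) (f x) = dot x x.

Let fD x y : f (x + y)%R = (f x + f y)%R.
Proof. by rewrite -{1}[x]scale1r f_linear scale1r. Qed.

Let fB x y : f (x - y)%R = (f x - f y)%R.
Proof. by rewrite addrC -scaleN1r f_linear scaleN1r addrC. Qed.

Let mshift (s : bool) :
  measurable_fun setT (fun z : V * V => if s then (z.1 + f z.2)%R else (z.1 - f z.2)%R).
Proof.
apply: measurable_fun_mx => i j.
have m1 : measurable_fun setT (fun z : V * V => z.1 i j).
  exact: (measurableT_comp (measurable_coord i j) (@measurable_fst _ _ _ _)).
have m2 : measurable_fun setT (fun z : V * V => f z.2 i j).
  apply: (measurableT_comp (measurable_coord i j)).
  exact: (measurableT_comp mf (@measurable_snd _ _ _ _)).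
case: s.
  rewrite (_ : (fun _ => _) = fun z : V * V => (z.1 i j + f z.2 i j)%R).
    exact: measurable_funD.
  by apply/funext => z; rewrite mxE.
rewrite (_ : (fun _ => _) = fun z : V * V => (z.1 i j - f z.2 i j)%R).
  exact: measurable_funB.
by apply/funext => z; rewrite !mxE.
Qed.

(* Evaluating the [nu \x nu]-measure of [{(x, y) | x \in A, x - f y \in pb}]
   in both orders shows that [A] and [f @^-1` A] have the same measure. *)
Lemma translation_invariant_involution (A : set V) : measurable A ->
  nu (f @^-1` A) = nu A.
Proof.
move=> mA.
pose E : set (V * V) := (fst @^-1` A) `&` ((fun z => z.1 - f z.2)%R @^-1` pb).
pose E' : set (V * V) := (fst @^-1` pb) `&` ((fun z => z.1 + f z.2)%R @^-1` A).
have mpb := @measurable_punctured_ball R d.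
have mE : measurable E.
  apply: measurableI; first exact: (preimageT_measurable (@measurable_fst _ _ _ _)).
  exact: (preimageT_measurable (mshift false)).
have mE' : measurable E'.
  apply: measurableI; first exact: (preimageT_measurable (@measurable_fst _ _ _ _)).
  exact: (preimageT_measurable (mshift true)).
have prodE X : measurable X -> (nu \x nu) X = (nu \x^ nu) X.
  move=> mX; apply: (@product_measure_unique _ _ _ _ _ nu nu (nu \x^ nu)%E) => //.
  by move=> ? ? ? ?; exact: product_measure2E.
(* For fixed [y] the two sections differ by the translation by [f y]. *)
have EE' : (nu \x nu) E = (nu \x nu) E'.
  rewrite !prodE//; apply: eq_integral => y _ /=.
  rewrite -(@nu_translation (f y)); last exact: measurable_ysection.
  congr (nu _); apply/seteqP; split => x; rewrite /E /E' /ysection /= !in_setE /=.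
    by rewrite addrK => -[].
  by rewrite addrK => -[].
(* For fixed [x] in [A] the section is a translate of [pb], because [pb] is invariant under [f] and
   under negation. *)
have EA : (nu \x nu) E = nu pb * nu A.
  transitivity (\int[nu]_x (nu pb * (\1_A x)%:E)); last first.
    by rewrite ge0_integralZl ?integral_indic ?setIT//; exact: measurableT_comp.
  apply: eq_integral => x _ /=; rewrite indicE.
  have [xA|xA] := boolP (x \in A); last first.
    rewrite mule0 (_ : xsection E x = set0) ?measure0//.
    apply/seteqP; split => y //; rewrite /xsection /= in_setE => -[/= Ax _].
    by move: xA; rewrite notin_setE.
  rewrite mule1 -[RHS](@nu_translation (- f x)%R)//.
  rewrite -(@nu_translation 0%R); last exact: measurable_xsection.
  congr (nu _); apply/seteqP; split => y; rewrite /xsection /= !in_setE /E /= addr0.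
    move=> [_]; rewrite /punctured_ball /= -f_dot fB fK.
    by rewrite -opprB dotNl dotNr opprK.
  move=> h; split; first by rewrite in_setE in xA.
  move: h; rewrite /punctured_ball /= -f_dot fB fK.
  by rewrite -opprB dotNl dotNr opprK.
have E'A : (nu \x nu) E' = nu pb * nu (f @^-1` A).
  have mfA : measurable (f @^-1` A) by exact: preimageT_measurable.
  transitivity (\int[nu]_x ((\1_pb x)%:E * nu (f @^-1` A))); last first.
    rewrite ge0_integralZr ?integral_indic ?setIT//.
    by apply/measurable_EFinP; exact: measurable_indic.
  apply: eq_integral => x _ /=; rewrite indicE.
  have [xb|xb] := boolP (x \in pb); last first.
    rewrite mul0e (_ : xsection E' x = set0) ?measure0//.
    apply/seteqP; split => y //; rewrite /xsection /= in_setE => -[/= Ax _].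
    by move: xb; rewrite notin_setE.
  rewrite mul1e -[RHS](@nu_translation (f x)%R)//.
  congr (nu _); apply/seteqP; split => y; rewrite /xsection /= !in_setE /E' /=.
    by move=> [_]; rewrite fD fK addrC.
  by rewrite fD fK addrC => ?; split => //; rewrite in_setE in xb.
have pbfin : nu pb \is a fin_num.
  by rewrite ge0_fin_numE// nu_fin.
have {EE' EA E'A}eqA : nu pb * nu A = nu pb * nu (f @^-1` A).
  by rewrite -EA -E'A.
apply/eqP; rewrite eq_le.
by apply/andP; split; rewrite -(lee_pmul2l pbfin nu_gt0) eqA lexx.
Qed.

End haar.

Lemma lebesgue_cV_refl v (A : set V) : measurable A ->
  mu (refl v @^-1` A) = mu A.
Proof.
apply: translation_invariant_involution.
- by move=> h B mB; exact: lebesgue_cV_translation.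
- exact: punctured_ball_gt0.
- exact: punctured_ball_fin.
- exact: measurable_refl.
- exact: refl_linear.
- exact: reflK.
- by move=> x; exact: dot_refl.
Qed.


Lemma sigma_circE (A : set V) :
  sigma_circ R d A = mu (pb `&` @direction R d @^-1` A) * (fine (mu pb))^-1%:E.
Proof.
have E : cone_measure [set: V] = mu pb.
  by rewrite /cone_measure preimage_setT setIT.
rewrite /sigma_circ /= /mnormalize [X in X == 0]E [X in X == +oo]E ifF ?[X in fine X]E//.
by rewrite gt_eqF ?punctured_ball_gt0//= lt_eqF// punctured_ball_fin.
Qed.

Lemma sigma_circ_refl v (A : set V) : measurable A ->
  sigma_circ R d (refl v @^-1` A) = sigma_circ R d A.
Proof.
move=> mA; rewrite !sigma_circE; congr (_ * _).
rewrite -[RHS](lebesgue_cV_refl v); last first.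
  apply: measurableI; first exact: measurable_punctured_ball.
  exact: (preimageT_measurable (@measurable_direction R d)).
by congr (mu _); apply/seteqP; split => x;
  rewrite /punctured_ball /direction /= dot_refl -reflZ.
Qed.

End orthogonal_invariance.

(** * Geodesic balls *)

Section geodesic_distance.
Variables (R : realType) (d : nat).
Local Notation V := ('cV[R]_d.+1).
Implicit Types (x y z v p : V) (r s t : R).

Lemma geo_dist_itv x y : sphere x -> sphere y -> 0 <= geo_dist x y <= pi.
Proof. by move=> Sx Sy; have [] := acos_def (dot_unit_le1 Sx Sy). Qed.

Lemma cos_geo_dist x y : sphere x -> sphere y -> cos (geo_dist x y) = dot x y.
Proof. by move=> Sx Sy; have [] := acos_def (dot_unit_le1 Sx Sy). Qed.

Lemma geo_distC x y : geo_dist x y = geo_dist y x.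
Proof. by rewrite /geo_dist dotC. Qed.

Lemma geo_distxx x : sphere x -> geo_dist x x = 0.
Proof. by rewrite /geo_dist /sphere /= => ->; rewrite acos1. Qed.

Lemma geo_dist_lt x y r : sphere x -> sphere y -> 0 <= r <= pi ->
  (geo_dist x y < r) = (cos r < dot x y).
Proof.
move=> Sx Sy rpi; rewrite -cos_geo_dist// ltr_cos// in_itv/=.
exact: geo_dist_itv.
Qed.

Lemma geo_dist_ge x y r : sphere x -> sphere y -> 0 <= r <= pi ->
  (r <= geo_dist x y) = (dot x y <= cos r).
Proof. by move=> Sx Sy rpi; rewrite leNgt geo_dist_lt// -leNgt. Qed.

Lemma geo_dist_gt x y r : sphere x -> sphere y -> 0 <= r <= pi ->
  (r < geo_dist x y) = (dot x y < cos r).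
Proof.
move=> Sx Sy rpi; rewrite -cos_geo_dist// ltr_cos// in_itv/=.
exact: geo_dist_itv.
Qed.

Lemma geo_dist_le x y r : sphere x -> sphere y -> 0 <= r <= pi ->
  (geo_dist x y <= r) = (cos r <= dot x y).
Proof. by move=> Sx Sy rpi; rewrite leNgt geo_dist_gt// -leNgt. Qed.

(** Cauchy-Schwarz is applied to the components of [x] and [z] orthogonal to [y]: their norms are
    the sines of the two distances, and the outcome is the addition formula for the cosine as a
    lower bound for [dot x z]. *)
Lemma geo_dist_triangle x y z : sphere x -> sphere y -> sphere z ->
  geo_dist x z <= geo_dist x y + geo_dist y z.
Proof.
move=> Sx Sy Sz.
have /andP[a0 api] := geo_dist_itv Sx Sy.
have /andP[b0 bpi] := geo_dist_itv Sy Sz.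
have [ab|/ltW ab] := leP (geo_dist x y + geo_dist y z) pi; last first.
  by apply: le_trans ab; have /andP[] := geo_dist_itv Sx Sz.
rewrite geo_dist_le// ?addr_ge0// cosD !cos_geo_dist//.
set sa := sin _; set sb := sin _.
have sa0 : 0 <= sa by rewrite sin_ge0_pi// a0.
have sb0 : 0 <= sb by rewrite sin_ge0_pi// b0.
have sa2 : sa ^+ 2 = 1 - dot x y ^+ 2 by rewrite sin2cos2 cos_geo_dist.
have sb2 : sb ^+ 2 = 1 - dot y z ^+ 2 by rewrite sin2cos2 cos_geo_dist.
have := CauchySchwarz (x - dot x y *: y) (z - dot y z *: y).
have -> : dot (x - dot x y *: y) (x - dot x y *: y) = sa ^+ 2.
  by rewrite sa2 !dotE Sx Sy (dotC y x); ring.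
have -> : dot (z - dot y z *: y) (z - dot y z *: y) = sb ^+ 2.
  by rewrite sb2 !dotE Sz Sy (dotC z y); ring.
have -> : dot (x - dot x y *: y) (z - dot y z *: y) = dot x z - dot x y * dot y z.
  by rewrite !dotE Sy; ring.
rewrite -exprMn; have := mulr_ge0 sa0 sb0.
by move: (sa * sb) (dot x z) (dot x y * dot y z) => P u w P0 ?; nra.
Qed.


Lemma measurable_sphere : measurable (@sphere R d).
Proof.
rewrite (_ : sphere = (fun x : V => dot x x : measurableTypeR R) @^-1` [set 1]).
  by apply: preimageT_measurable => //; exact: measurable_dot.
by apply/seteqP; split.
Qed.

Lemma measurable_dot_ge x r : measurable [set y | r <= dot x y].
Proof.
rewrite (_ : mkset _ = (dot x : V -> measurableTypeR R) @^-1` `[r, +oo[%classic).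
  by apply: preimageT_measurable => //; exact: measurable_dotl.
by apply/seteqP; split => y /=; rewrite in_itv/= andbT.
Qed.

Lemma measurable_dot_gt x r : measurable [set y | r < dot x y].
Proof.
rewrite (_ : mkset _ = (dot x : V -> measurableTypeR R) @^-1` `]r, +oo[%classic).
  by apply: preimageT_measurable => //; exact: measurable_dotl.
by apply/seteqP; split => y /=; rewrite in_itv/= andbT.
Qed.

Definition open_geo_ball x r : set V := [set y | sphere y /\ geo_dist x y < r].

Lemma measurable_geo_ball x r : sphere x -> measurable (geo_ball x r).
Proof.
move=> Sx; have [r0|r0] := ltP r 0.
  rewrite (_ : geo_ball x r = set0)//; apply/seteqP; split => // y [Sy].
  by have /andP[] := geo_dist_itv Sx Sy => ? _ ?; exfalso; lra.
have [rpi|/ltW rpi] := leP r pi.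
  rewrite (_ : geo_ball x r = sphere `&` [set y | cos r <= dot x y]).
    by apply: measurableI; [exact: measurable_sphere|exact: measurable_dot_ge].
  by apply/seteqP; split => y; rewrite /geo_ball /= => -[Sy]; rewrite geo_dist_le ?r0.
rewrite (_ : geo_ball x r = sphere); first exact: measurable_sphere.
apply/seteqP; split => y; first by case.
by move=> Sy; split => //; apply: le_trans rpi; have /andP[] := geo_dist_itv Sx Sy.
Qed.

Lemma measurable_open_geo_ball x r : sphere x -> measurable (open_geo_ball x r).
Proof.
move=> Sx; have [r0|/ltW r0] := leP r 0.
  rewrite (_ : open_geo_ball x r = set0)//; apply/seteqP; split => // y [Sy].
  by have /andP[] := geo_dist_itv Sx Sy => ? _ ?; exfalso; lra.
have [rpi|rpi] := leP r pi.
  rewrite (_ : open_geo_ball x r = sphere `&` [set y | cos r < dot x y]).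
    by apply: measurableI; [exact: measurable_sphere|exact: measurable_dot_gt].
  by apply/seteqP; split => y; rewrite /open_geo_ball /= => -[Sy]; rewrite geo_dist_lt ?r0.
rewrite (_ : open_geo_ball x r = sphere); first exact: measurable_sphere.
apply/seteqP; split => y; first by case.
by move=> Sy; split => //; apply: le_lt_trans rpi; have /andP[] := geo_dist_itv Sx Sy.
Qed.

Lemma sphere_refl v x : sphere (refl v x) <-> sphere x.
Proof. by rewrite /sphere /= dot_refl. Qed.

Lemma geo_ball_refl v x r : refl v @^-1` geo_ball x r = geo_ball (refl v x) r.
Proof.
by apply/seteqP; split => y /=; rewrite /geo_ball /geo_dist /= dot_reflC => -[/sphere_refl ? ?].
Qed.

(** A first reflection takes [x] to [x'] and [y] to some [z]. The second takes [z] to [y'] and fixes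
    [x'], since equality of the inner products makes [z - y'] orthogonal to [x']. *)
Lemma sigma_circ_balls x y x' y' r s : sphere x -> sphere y ->
  sphere x' -> sphere y' -> dot x y = dot x' y' ->
  sigma_circ R d (geo_ball x r `|` geo_ball y s) =
  sigma_circ R d (geo_ball x' r `|` geo_ball y' s).
Proof.
move=> Sx Sy Sx' Sy' xy.
have mU u v : sphere u -> sphere v -> measurable (geo_ball u r `|` geo_ball v s).
  by move=> Su Sv; apply: measurableU; exact: measurable_geo_ball.
rewrite -(sigma_circ_refl (x - x') (mU _ _ Sx Sy)) preimage_setU !geo_ball_refl.
rewrite refl_swap ?Sx ?Sx'//; set z := refl _ y.
have Sz : sphere z by exact/sphere_refl.
rewrite -(sigma_circ_refl (z - y') (mU _ _ Sx' Sz)) preimage_setU !geo_ball_refl.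
rewrite refl_swap ?Sz ?Sy'// refl_orth// dotBl.
rewrite [dot y' x']dotC -xy dotC -[in dot x y](dot_refl (x - x')).
by rewrite refl_swap ?Sx ?Sx'// subrr.
Qed.

Lemma sigma_circ_geo_ball x x' r : sphere x -> sphere x' ->
  sigma_circ R d (geo_ball x r) = sigma_circ R d (geo_ball x' r).
Proof.
move=> Sx Sx'; rewrite -(setUid (geo_ball x r)) -(setUid (geo_ball x' r)).
by apply: sigma_circ_balls => //; rewrite Sx Sx'.
Qed.

Lemma sphere_direction x : punctured_ball x -> sphere (direction x).
Proof.
move=> /andP[x0 _]; rewrite /sphere /direction /= dotZl dotZr mulrA.
rewrite -invfM -expr2 sqr_sqrtr ?mulVf ?gt_eqF//; exact: ltW.
Qed.

Lemma sigma_circ_sphere : sigma_circ R d sphere = 1%E.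
Proof.
rewrite -(probability_setT (sigma_circ R d)) !sigma_circE preimage_setT setIT.
congr (lebesgue_cV _ _ _ * _)%E; apply/seteqP; split => x; first by case.
by move=> xb; split => //=; exact: sphere_direction.
Qed.

End geodesic_distance.

(** * Level sets of the distance are null *)

Section slices.
Variables (R : realType) (d : nat).
Local Notation V := ('cV[R]_d.+1).
Local Notation leb := (@lebesgue_measure R).

Definition sqn n (y : 'cV[R]_n) : R := \sum_i y i 0 ^+ 2.

Lemma sqn_ge0 n (y : 'cV[R]_n) : 0 <= sqn y.
Proof. by apply: sumr_ge0 => i _; rewrite sqr_ge0. Qed.

Lemma measurable_sqn n : measurable_fun setT (@sqn n : _ -> measurableTypeR R).
Proof.
apply: measurable_sum => i; apply: measurable_funX; exact: measurable_coord.
Qed.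

Lemma cons_cV0 n z : @cons_cV R n z ord0 ord0 = z.1.
Proof.
by have := congr1 fst (cons_cVK z).
Qed.

Lemma cons_cVS n z i : @cons_cV R n z (lift ord0 i) ord0 = z.2 i ord0.
Proof.
rewrite -[in RHS](cons_cVK z) /uncons_cV /= [in RHS]mxE.
by congr (fun_of_matrix _ _ _); exact/val_inj.
Qed.

Lemma dot_cons z : dot (@cons_cV R d z) (cons_cV z) = z.1 ^+ 2 + sqn z.2.
Proof.
rewrite /dot big_ord_recl cons_cV0 -expr2; congr (_ + _).
by apply: eq_bigr => i _; rewrite cons_cVS expr2.
Qed.

Definition pole : V := delta_mx ord0 ord0.

Lemma dot_pole x : dot pole x = x ord0 ord0.
Proof.
rewrite /dot big_ord_recl mxE !eqxx mul1r big1 ?addr0// => i _.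
by rewrite mxE mul0r.
Qed.

Lemma sphere_pole : sphere pole.
Proof. by rewrite /sphere /= dot_pole mxE !eqxx. Qed.

Lemma lebesgue_cVS (A : set V) :
  lebesgue_cV R d.+1 A = (leb \x lebesgue_cV R d)%E (@cons_cV R d @^-1` A).
Proof. by []. Qed.

Lemma measurable_level p r : measurable (sphere `&` [set y : V | dot p y = r]).
Proof.
apply: measurableI; first exact: measurable_sphere.
rewrite (_ : mkset _ = (dot p : V -> measurableTypeR R) @^-1` [set r]).
  by apply: preimageT_measurable => //; exact: measurable_dotl.
by apply/seteqP; split.
Qed.

(** A reflection moves [p] to the pole, and the cone over the level set then lies in the quadric
    [B]. Since [1 - r ^+ 2] is positive, for fixed [y] at most the two values [k] and [- k] of the
    first coordinate satisfy its equation; Fubini with that coordinate innermost gives measure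
    zero. *)
Lemma sigma_circ_level0 (p : V) r : sphere p -> -1 < r < 1 ->
  sigma_circ R d (sphere `&` [set y | dot p y = r]) = 0%E.
Proof.
move=> Sp r1.
have -> : sigma_circ R d (sphere `&` [set y | dot p y = r]) =
    sigma_circ R d (sphere `&` [set y | dot pole y = r]).
  rewrite -(sigma_circ_refl (p - pole) (measurable_level p r)).
  congr (sigma_circ _ _ _); apply/seteqP; split => y /=;
    rewrite -dot_reflC refl_swap ?Sp ?sphere_pole//;
    by move=> [/sphere_refl].
rewrite sigma_circE.
set A := (X in lebesgue_cV _ _ X).
pose B : set (measurableTypeR R * 'cV[R]_d) :=
  [set z | z.1 ^+ 2 * (1 - r ^+ 2) = r ^+ 2 * sqn z.2].
have mA : measurable A.
  apply: measurableI; first exact: measurable_punctured_ball.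
  apply: (preimageT_measurable (@measurable_direction R d)).
  exact: measurable_level.
have mB : measurable B.
  rewrite (_ : B = (fun z : measurableTypeR R * 'cV[R]_d =>
    z.1 ^+ 2 * (1 - r ^+ 2) - r ^+ 2 * sqn z.2 : measurableTypeR R) @^-1` [set 0]).
    apply: preimageT_measurable => //; apply: measurable_funB.
      by apply: measurable_funM => //; apply: measurable_funX; exact: measurable_fst.
    apply: measurable_funM => //; apply: (measurableT_comp (@measurable_sqn d)).
    exact: measurable_snd.
  apply/seteqP; split => z; rewrite /B /=; first by move=> ->; rewrite subrr.
  by move/eqP; rewrite subr_eq0 => /eqP.
rewrite lebesgue_cVS (_ : (_ \x _)%E _ = 0%E) ?mul0e//; apply/eqP.
rewrite eq_le measure_ge0 andbT.
apply: (@le_trans _ _ ((leb \x lebesgue_cV R d)%E B)).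
  apply: le_measure; rewrite ?in_setE.
  - exact: (preimageT_measurable (@measurable_cons_cV R d)).
  - exact: mB.
  move=> z [/= zb [_]]; rewrite dot_pole /direction mxE cons_cV0.
  move: zb; rewrite /punctured_ball /B /= dot_cons => /andP[z0 _].
  have : Num.sqrt (z.1 ^+ 2 + sqn z.2) ^+ 2 = z.1 ^+ 2 + sqn z.2 by rewrite sqr_sqrtr// ltW.
  rewrite -sqrtr_gt0 in z0; move: (Num.sqrt _) z0 => q q0 q2 zr.
  have -> : z.1 = q * r by rewrite -zr mulrA mulfV ?gt_eqF// mul1r.
  move: q2; rewrite -zr => q2.
  have -> : sqn z.2 = q ^+ 2 - z.1 ^+ 2 by rewrite q2; ring.
  by field; rewrite gt_eqF.
rewrite (@product_measure_unique _ _ _ _ _ _ _ (leb \x^ lebesgue_cV R d)%E)//; last first.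
  by move=> ? ? ? ?; exact: product_measure2E.
rewrite [leLHS]integral0_eq// => y _ /=.
pose k := Num.sqrt (r ^+ 2 * sqn y / (1 - r ^+ 2)).
apply/eqP; rewrite eq_le measure_ge0 andbT.
have r20 : 0 < 1 - r ^+ 2 by case/andP: r1 => ? ?; nra.
have m2 : measurable ([set k; -k] : set (measurableTypeR R)).
  by apply: measurableU; exact: measurable_set1.
apply: (@le_trans _ _ (leb [set k; -k])).
  apply: le_measure; rewrite ?in_setE//; first exact: measurable_ysection.
  move=> t; rewrite /ysection /= in_setE /B /= => tE.
  have : t ^+ 2 = k ^+ 2.
    rewrite sqr_sqrtr; last first.
      by apply: divr_ge0; [exact: mulr_ge0 (sqr_ge0 _) (sqn_ge0 _)|exact: ltW].
    by rewrite -tE mulfK// gt_eqF.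
  by move=> /eqP; rewrite eqf_sqr => /orP[] /eqP ->; [left|right].
rewrite countable_lebesgue_measure0//.
by apply: finite_set_countable; exact: finite_set2.
Qed.

End slices.

(** * Thin shells and fine partitions of the sphere *)

Section caps.
Variables (R : realType) (d : nat).
Local Notation V := ('cV[R]_d.+1).
Local Notation sigma := (sigma_circ R d).
Local Notation sig A := (fine (sigma_circ R d A)).

Lemma sigEFin (A : set V) : measurable A -> (sig A)%:E = sigma A.
Proof. by move=> mA; rewrite fineK// fin_num_measure. Qed.

Lemma sig_ge0 (A : set V) : 0 <= sig A.
Proof. by rewrite fine_ge0. Qed.

Lemma sig_le (A B : set V) : measurable A -> measurable B -> A `<=` B ->
  sig A <= sig B.
Proof.
by move=> mA mB AB; rewrite -lee_fin !sigEFin// le_measure ?in_setE.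
Qed.

Lemma sig_leU (A B : set V) : measurable A -> measurable B ->
  sig (A `|` B) <= sig A + sig B.
Proof.
move=> mA mB; rewrite -lee_fin EFinD !sigEFin//; last exact: measurableU.
exact: measureU2.
Qed.

Lemma sig_bigcup (I : finType) (F : I -> set V) :
  (forall i, measurable (F i)) -> (forall i j x, F i x -> F j x -> i = j) ->
  sig (\bigcup_i F i) = \sum_i sig (F i).
Proof.
move=> mF F_disj; have mU : measurable (\bigcup_i F i).
  by apply: fin_bigcup_measurable => //; exact: finite_finset.
apply: EFin_inj; rewrite -sumEFin sigEFin// measure_fin_bigcup//; last 2 first.
- exact: finite_finset.
- by move=> i j _ _ [x [Fi Fj]]; exact: F_disj Fi Fj.
rewrite (fsbigE (index_enum I)) ?index_enum_uniq//; last first.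
  by move=> i _; rewrite mem_index_enum.
by apply: eq_big => [i|i _]; rewrite ?in_setT// sigEFin.
Qed.

Definition shell (p : V) (th r : R) : set V :=
  geo_ball p (th + r) `\` open_geo_ball p (th - r).

Lemma measurable_shell p th r : sphere p -> measurable (shell p th r).
Proof.
move=> Sp; apply: measurableD; first exact: measurable_geo_ball.
exact: measurable_open_geo_ball.
Qed.

(** The shells decrease to the level set at distance [th], which is null, so continuity from above
    applies. *)
Lemma shell_small (p : V) (th eta : R) : sphere p -> 0 < th < pi -> 0 < eta ->
  exists2 r, 0 < r & sig (shell p th r) <= eta.
Proof.
move=> Sp /andP[th0 thpi] eta0.
pose F k := shell p th k.+1%:R^-1.
have mF k : measurable (F k) by exact: measurable_shell.
have capF : \bigcap_k F k = sphere `&` [set y | dot p y = cos th].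
  apply/seteqP; split => y.
    move=> Fy; have Sy : sphere y by have [[]] := Fy 0%N I.
    split => //=; rewrite -cos_geo_dist//; congr cos.
    have small e : 0 < e -> exists k, k.+1%:R^-1 < e :> R.
      move=> e0; exists (Num.truncn e^-1).
      by rewrite invf_plt ?posrE// truncnS_gt.
    apply/eqP; rewrite eq_le; apply/andP; split; apply/(@ler_addgt0Pl R) => e /small[k ke].
      by have [[_ h] _] := Fy k I; apply: le_trans h _; rewrite addrC lerD2r ltW.
    have [//|lt_th] := leP th (e + geo_dist p y).
    have [_ h] := Fy k I; exfalso; apply: h; split => //.
    by rewrite ltrBrDr (lt_trans _ lt_th)// addrC ltrD2r.
  move=> [Sy /= cy] k _.
  have dth : geo_dist p y = th.
    apply: cos_inj; rewrite ?in_itv/= ?geo_dist_itv ?(ltW th0) ?ltW//.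
    by rewrite cos_geo_dist.
  split; first by split => //; rewrite dth lerDl invr_ge0.
  by move=> [_]; rewrite dth ltrBrDr gtrDl ltNge invr_ge0 ler0n.
have c0 : sigma (\bigcap_k F k) = 0%E.
  rewrite capF sigma_circ_level0//.
  rewrite -cospi -[X in _ && (_ < X)]cos0 !ltr_cos ?in_itv/= ?lexx ?pi_ge0 ?(ltW th0) ?(ltW thpi)//.
  by rewrite th0 thpi.
have : sigma \o F @ \oo --> sigma (\bigcap_k F k).
  apply: nonincreasing_cvg_mu => //.
  - by rewrite -ge0_fin_numE// fin_num_measure.
  - by rewrite capF; exact: measurable_level.
  move=> m n mn; apply/subsetPset => y [[Sy h1] h2].
  have mn' : n.+1%:R^-1 <= m.+1%:R^-1 :> R.
    by rewrite lef_pV2 ?posrE ?ltr0n// ler_nat ltnS.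
  split; first by split => //; apply: le_trans h1 _; rewrite lerD2l.
  move=> [_ h]; apply: h2; split => //; apply: lt_le_trans h _.
  by rewrite lerD2l lerN2.
rewrite c0 => /fine_cvgP[_ /cvgrPdist_le /(_ _ eta0)[k _ /(_ _ (leqnn k))]].
rewrite /= sub0r normrN ger0_norm ?sig_ge0// => h.
by exists k.+1%:R^-1; rewrite ?invr_gt0.
Qed.

Lemma geo_ball_subW (x : V) r s : r <= s -> geo_ball x r `<=` geo_ball x s.
Proof. by move=> rs y [Sy h]; split => //; exact: le_trans rs. Qed.

(** The pieces are cut out by a grid of cubes of side [1 / N]. Two points of one piece have squared
    euclidean distance at most [d.+1 / N], which the choice of [N] makes smaller than [1 - cos r1];
    on the sphere this forces their geodesic distance below [r1]. *)
Lemma sphere_partition (r : R) : 0 < r ->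
  exists (I : finType) (Q : I -> set V) (q : I -> V),
    [/\ forall i, measurable (Q i),
        forall i j x, Q i x -> Q j x -> i = j,
        forall x, sphere x -> exists i, Q i x,
        forall i, sphere (q i) &
        forall i x, Q i x -> sphere x /\ geo_dist (q i) x <= r].
Proof.
move=> r0; pose r1 := Num.min r (pi / 2).
have r1_0 : 0 < r1 by rewrite lt_min r0 divr_gt0// pi_gt0.
have r1pi : r1 <= pi by rewrite ge_min; apply/orP; right; have := pi_gt0 R; lra.
have c1 : 0 < 1 - cos r1.
  rewrite subr_gt0 -cos0 ltr_cos// in_itv/= ?lexx ?pi_ge0// r1pi andbT; exact: ltW.
pose N := (Num.truncn (d.+1%:R / (1 - cos r1))).+1.
have NE : d.+1%:R < N%:R * (1 - cos r1) by rewrite -ltr_pdivrMr// truncnS_gt.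
have N1 : 1 <= N%:R :> R by rewrite ler1n.
(* The value [N * (x i + 1)] ranges over the closed interval from 0 to [2 * N], hence one index more
   than [2 * N]. *)
pose T : finType := {ffun 'I_d.+1 -> 'I_(N.*2.+1)}.
pose Q (k : T) : set V := sphere `&`
  \bigcap_(i in [set: 'I_d.+1]) [set x | (k i)%:R <= N%:R * (x i ord0 + 1) < (k i).+1%:R].
have coord (x : V) i : sphere x -> -1 <= x i ord0 <= 1.
  move=> Sx; have : x i ord0 ^+ 2 <= 1.
    rewrite -Sx /dot (bigD1 i)//= -expr2 lerDl.
    by apply: sumr_ge0 => k _; rewrite -expr2 sqr_ge0.
  by move=> ?; apply/andP; split; nra.
(* Empty pieces receive the pole, so that every center lies on the sphere. *)
exists T, Q, (fun k => if pselect (Q k !=set0) then xget (pole R d) (Q k) else pole R d).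
split.
- move=> k; apply: measurableI; first exact: measurable_sphere.
  apply: fin_bigcap_measurable => // i _.
  rewrite [X in measurable X](_ : _ = (fun x : V => N%:R * (x i ord0 + 1) : measurableTypeR R)
      @^-1` `[(k i)%:R, (k i).+1%:R[%classic); last first.
    by apply/seteqP; split => x /=; rewrite in_itv/=.
  apply: preimageT_measurable => //; apply: measurable_funM => //.
  by apply: measurable_funD => //; exact: measurable_coord.
- move=> i j x [_ xi] [_ xj]; apply/ffunP => l; apply/val_inj/eqP.
  have /andP[i1 i2] := xi l I; have /andP[j1 j2] := xj l I.
  have := le_lt_trans i1 j2; have := le_lt_trans j1 i2.
  by rewrite !ltr_nat !ltnS eqn_leq => -> ->.
- move=> x Sx.
  have h i : 0 <= N%:R * (x i ord0 + 1) by have /andP[? ?] := coord x i Sx; nra.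
  have lt i : (Num.truncn (N%:R * (x i ord0 + 1)) < N.*2.+1)%N.
    rewrite ltnS -(ler_nat R) -muln2 natrM; have /andP[t1 _] := truncn_itv (h i).
    by apply: le_trans t1 _; have /andP[? ?] := coord x i Sx; nra.
  exists [ffun i => Ordinal (lt i)]; split => // i _ /=; rewrite ffunE /=.
  exact: truncn_itv.
- move=> k; case: pselect => [Qk|nQ]; last exact: sphere_pole.
  have : Q k (xget (pole R d) (Q k)) by case: Qk => y; exact: xgetI.
  by case.
- move=> k x Qx; split; first by case: Qx.
  case: pselect => [Qk|[]]; last by exists x.
  have : Q k (xget (pole R d) (Q k)) by case: Qk => y; exact: xgetI.
  move: (xget _ _) => y Qy.
  have [Sx xk] := Qx; have [Sy yk] := Qy.
  apply: (@le_trans _ _ r1); last by rewrite ge_min lexx.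
  rewrite geo_dist_le// ?r1pi ?ltW//.
  have : dot (y - x) (y - x) <= d.+1%:R * N%:R^-1.
    apply: (@le_trans _ _ (\sum_(i < d.+1) N%:R^-1)); last first.
      by rewrite sumr_const card_ord -[leLHS]mulr_natl.
    apply: ler_sum => i _; rewrite !mxE.
    have /andP[x1 x2] := xk i I; have /andP[y1 y2] := yk i I.
    move: x1 x2 y1 y2; rewrite -natr1 => x1 x2 y1 y2.
    rewrite -[leRHS]mul1r ler_pdivlMr; last lra.
    move: N1 x1 x2 y1 y2.
    move: (y i ord0) (x i ord0) (N%:R : R) ((k i)%:R : R) => u v n m N1 x1 x2 y1 y2.
    have a1 : -1 < n * (u - v) by lra.
    have a2 : n * (u - v) < 1 by lra.
    have a3 : (n * (u - v)) ^+ 2 <= 1 by nra.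
    have a4 : 0 <= (n - 1) * (n * (u - v) ^+ 2) by apply: mulr_ge0; [lra|apply: mulr_ge0; [lra|exact: sqr_ge0]].
    by nra.
  rewrite !dotE Sx Sy (dotC x y) => h.
  have : d.+1%:R * N%:R^-1 < 1 - cos r1 by rewrite ltr_pdivrMr 1?mulrC//; lra.
  lra.
Qed.

End caps.

(** * The typical cell of a discretised Poisson process *)

Section integral_aux.
Context d (T : measurableType d) (R : realType).
Variable mu : {measure set T -> \bar R}.
Local Open Scope ereal_scope.

(* The integral of a nonnegative function is defined as a supremum over simple
   functions, hence is monotone without measurability assumptions. *)
Lemma integral_le_nomeas (f g : T -> \bar R) : (forall x, 0 <= f x) ->
  (forall x, f x <= g x) -> \int[mu]_x f x <= \int[mu]_x g x.
Proof.
move=> f0 fg; have g0 x : 0 <= g x := le_trans (f0 x) (fg x).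
rewrite !ge0_integralTE//; apply: le_ereal_sup => _ [h hf <-].
by exists h => // x; exact: le_trans (hf x) (fg x).
Qed.

(** Rather than changing [f], which carries no measurability, on the null set, [g] is raised to
    [+oo] there; this leaves the integral of [g] unchanged. *)
Lemma integral_le_offnull (f g : T -> \bar R) (N : set T) :
  measurable N -> mu N = 0 -> measurable_fun setT g -> (forall x, 0 <= f x) ->
  (forall x, 0 <= g x) -> (forall x, ~ N x -> f x <= g x) ->
  \int[mu]_x f x <= \int[mu]_x g x.
Proof.
move=> mN N0 mg f0 g0 fg.
have mcst : measurable_fun setT ((cst +oo : T -> \bar R) \_ N).
  by apply/(measurable_restrictT _ _).1.
have cst0 x : 0 <= ((cst +oo : T -> \bar R) \_ N) x.
  by rewrite patchE; case: ifPn => // _; exact: leey.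
apply: (@le_trans _ _ (\int[mu]_x (g x + ((cst +oo : T -> \bar R) \_ N) x))).
  apply: integral_le_nomeas => // x; rewrite patchE; case: ifPn => xN.
    by rewrite addey ?leey// -ltNye (lt_le_trans _ (g0 x)).
  by rewrite adde0 fg//; move: xN; rewrite notin_setE.
by rewrite ge0_integralD// -[X in _ + X]integral_mkcond integral_cst// N0 mule0 adde0.
Qed.

End integral_aux.

(** * Integrals over the rotation kernel *)

Section rotations.
Variables (R : realType) (d : nat).
Local Notation V := ('cV[R]_d.+1).
Local Notation M := ('M[R]_d.+1).

Lemma measurable_SO : measurable (@SO R d).
Proof.
apply: measurableI.
  rewrite [X in measurable X](_ : _ = \bigcap_(i in [set: 'I_d.+1]) \bigcap_(j in [set: 'I_d.+1])
     ((fun phi : M => \sum_k phi i k * phi j k : measurableTypeR R)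
        @^-1` [set (1%:M : M) i j])).
    apply: fin_bigcap_measurable => // i _; apply: fin_bigcap_measurable => // j _.
    apply: preimageT_measurable => //; apply: measurable_sum => k.
    by apply: measurable_funM; exact: measurable_coord.
  apply/seteqP; split => phi.
    move=> h i _ j _ /=; rewrite -h mxE; apply: eq_bigr => k _.
    by rewrite [phi^T _ _]mxE.
  move=> h; apply/matrixP => i j; rewrite -(h i I j I) mxE.
  by apply: eq_bigr => k _; rewrite [phi^T _ _]mxE.
rewrite [X in measurable X](_ : _ =
    (fun phi : M => \det phi : measurableTypeR R) @^-1` [set 1])//.
apply: preimageT_measurable => //; apply: measurable_sum => s.
apply: measurable_funM => //; apply: measurable_prod => i _.
exact: measurable_coord.
Qed.

Lemma measurable_rot_fiber (p x : V) : measurable [set phi : M | phi *m p = x].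
Proof.
rewrite [X in measurable X](_ : _ = \bigcap_(i in [set: 'I_d.+1])
     ((fun phi : M => \sum_k phi i k * p k ord0 : measurableTypeR R)
        @^-1` [set x i ord0])).
  apply: fin_bigcap_measurable => // i _; apply: preimageT_measurable => //.
  by apply: measurable_sum => k; apply: measurable_funM => //; exact: measurable_coord.
apply/seteqP; split => phi.
  by move=> /= <- i _ /=; rewrite mxE.
move=> h; apply/matrixP => i j; rewrite (ord1 j) -(h i I) mxE.
by apply: eq_bigr.
Qed.

Variables (p : V) (kappa : R.-pker V ~> M).
Local Open Scope ereal_scope.

Definition cell_integral (E : set (set V)) (x : V) (Y : set V) : \bar R :=
  \int[kappa x]_phi (\1_[set psi | E ([set invmx psi *m y | y in voronoi_cell x Y])]
        phi)%:E.

Lemma cell_integral_ge0 E x Y : 0 <= cell_integral E x Y.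
Proof. by apply: integral_ge0 => phi _; rewrite lee_fin. Qed.

Lemma cell_integral_le1 E x Y : cell_integral E x Y <= 1.
Proof.
apply: (@le_trans _ _ (\int[kappa x]_phi cst 1 phi)).
  by apply: integral_le_nomeas => phi; rewrite lee_fin// indicE; case: (_ \in _).
by rewrite integral_cst// mul1e prob_kernel.
Qed.

Definition good_center (x : V) :=
  kappa x (~` @SO R d) = 0 /\ kappa x (~` [set phi | phi *m p = x]) = 0.

Let G x := @SO R d `&` [set phi | phi *m p = x].

Let mG x : measurable (G x).
Proof. by apply: measurableI; [exact: measurable_SO|exact: measurable_rot_fiber]. Qed.

Let GC0 x : good_center x -> kappa x (~` G x) = 0.
Proof.
move=> [h1 h2]; apply/eqP; rewrite eq_le measure_ge0 andbT setCI.
apply: le_trans (measureU2 _ _ _) _.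
- by apply: measurableC; exact: measurable_SO.
- by apply: measurableC; exact: measurable_rot_fiber.
by rewrite [X in X + _]h1 [X in _ + X]h2 adde0.
Qed.

(** If no such [psi] existed, the indicator would be dominated by that of the complement of [G x], a
    measurable null set for [kappa x]. *)
Lemma cell_integral_neq0 E x Y : good_center x -> cell_integral E x Y != 0 ->
  exists psi, [/\ SO psi, psi *m p = x &
    E ([set invmx psi *m y | y in voronoi_cell x Y])].
Proof.
move=> gx; apply: contra_neqP => nex; apply/eqP.
rewrite eq_le cell_integral_ge0 andbT.
apply: (@le_trans _ _ (\int[kappa x]_phi (\1_(~` G x) phi)%:E)).
  apply: integral_le_nomeas => phi; rewrite lee_fin// !indicE.
  case: (boolP (phi \in _)) => //; rewrite in_setE /= => Ephi.
  rewrite mem_set//= => -[Sphi phix]; apply: nex.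
  by exists phi; split.
rewrite integral_indic ?setIT ?[leLHS]GC0//.
exact: measurableC.
Qed.

Lemma cell_integral_eq1 E x Y : good_center x ->
  (forall psi, SO psi -> psi *m p = x ->
    E ([set invmx psi *m y | y in voronoi_cell x Y])) ->
  cell_integral E x Y = 1.
Proof.
move=> gx h; apply/eqP; rewrite eq_le cell_integral_le1/=.
have G1 : kappa x (G x) = 1.
  have := measureU (kappa x) (mG x) (measurableC (mG x)).
  rewrite setICr setUv => /(_ erefl).
  by move: (GC0 gx) => /= ->; rewrite adde0 => <-; rewrite prob_kernel.
apply: (@le_trans _ _ (\int[kappa x]_phi (\1_(G x) phi)%:E)).
  by rewrite integral_indic ?setIT ?[leRHS]G1.
apply: integral_le_nomeas => phi; rewrite lee_fin// !indicE.
case: (boolP (phi \in G x)) => //; rewrite in_setE => -[Sphi phix].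
by rewrite mem_set//=; exact: h.
Qed.

Lemma good_center_ae : rotation_kernel p kappa ->
  exists N, [/\ measurable N, sigma_circ R d N = 0 &
    forall x, sphere x -> ~ N x -> good_center x].
Proof.
move=> [kSO [N [mN N0 subN]]]; exists N; split => // x Sx Nx.
split; first exact: kSO.
by apply: contrapT => h; apply: Nx; exact: subN.
Qed.

End rotations.

(** * Counting isolated nuclei over a partition *)

Section poisson_counts.
Variables (R : realType) (d : nat).
Local Notation V := ('cV[R]_d.+1).
Local Notation sig A := (fine (sigma_circ R d A)).
Context (dO : measure_display) (Om : measurableType dO).
Variables (P : probability Om R) (X : Om -> set V) (gamma : R).
Hypothesis XP : isotropic_poisson P X gamma.

Lemma finite_XI w (B : set V) : finite_set (X w `&` B).
Proof. by apply: finite_setIl; exact: poisson_finite XP w. Qed.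

Lemma count0P (B : set V) w :
  Defs.count X B w = 0%N <-> forall z, X w z -> ~ B z.
Proof.
rewrite /Defs.count; split.
  move=> /cardfs0_eq h z Xz Bz; have : z \in fset_set (X w `&` B).
    by rewrite in_fset_set ?mem_set//; exact: finite_XI.
  by rewrite h in_fset0.
move=> h; rewrite (_ : X w `&` B = set0) ?fset_set0 ?cardfs0//.
by apply/seteqP; split => // z [] /h.
Qed.

Lemma count1P (B : set V) w :
  Defs.count X B w = 1%N <-> exists x, [/\ X w x, B x & forall z, X w z -> B z -> z = x].
Proof.
rewrite /Defs.count; split.
  move=> /eqP /cardfs1P[x xE].
  have memE z : (X w `&` B) z <-> z = x.
    rewrite -(in_setE (X w `&` B)) -in_fset_set ?xE; last exact: finite_XI.
    by rewrite in_fset1; split=> /eqP.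
  have [Xx Bx] := (memE x).2 erefl.
  by exists x; split => // z Xz Bz; apply/memE.
move=> [x [Xx Bx h]]; rewrite (_ : X w `&` B = [set x]) ?fset_set1 ?cardfs1//.
apply/seteqP; split => z /=; first by move=> [? ?]; exact: h.
by move=> ->.
Qed.

Definition isolated (Q A : set V) : set Om :=
  [set w | Defs.count X Q w = 1%N] `&` [set w | Defs.count X A w = 0%N].

Lemma measurable_count_eq (B : set V) k : measurable B ->
  measurable [set w | Defs.count X B w = k].
Proof.
move=> mB; rewrite (_ : mkset _ = Defs.count X B @^-1` [set k])//.
by apply: preimageT_measurable => //; exact: poisson_measurable XP _ mB.
Qed.

Lemma measurable_isolated (Q A : set V) : measurable Q -> measurable A ->
  measurable (isolated Q A).
Proof. by move=> mQ mA; apply: measurableI; exact: measurable_count_eq. Qed.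

Lemma isolated_prob (Q A : set V) : measurable Q -> measurable A ->
  Q `&` A = set0 ->
  P (isolated Q A) = (gamma * sig Q * expR (- (gamma * (sig Q + sig A))))%:E.
Proof.
move=> mQ mA QA.
pose B (i : 'I_2) := if i == ord0 then Q else A.
pose D (i : 'I_2) := if i == ord0 then [set 1%N] else [set 0%N].
have mB i : measurable (B i) by rewrite /B; case: ifP.
have tB : trivIset [set: 'I_2] B.
  apply/trivIsetP => i j _ _ ij; rewrite /B.
  case: ifPn => i0; case: ifPn => j0 //.
  - by move: ij; rewrite (eqP i0) (eqP j0) eqxx.
  - by rewrite setIC.
  exfalso; move: i0 j0 ij.
  by case: i => -[|[|[]]] // ?; case: j => -[|[|[]]].
have := poisson_independent XP D mB tB.
rewrite !big_ord_recl big_ord0 /= mule1 /B /D /= => indep.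
rewrite (_ : isolated Q A = \bigcap_i [set w | D i (Defs.count X (B i) w)]).
  rewrite indep.
  have := poisson_law XP 1 mQ; have := poisson_law XP 0 mA => /= -> ->.
  rewrite -EFinM; congr EFin; rewrite expr1 expr0 (factS 0) fact0 muln1 invr1 !mulr1 mul1r.
  by rewrite -[LHS]mulrA -expRD; congr (_ * expR _); ring.
apply/seteqP; split => w.
  by move=> [w1 w2] i _; rewrite /B /D /=; case: ifP.
by move=> h; split; [exact: (h ord0)|exact: (h (lift ord0 ord0))].
Qed.

(** Used to discard the nuclei at which the rotation kernel is not concentrated on rotations taking
    [p] to them. *)
Lemma count0_null (N : set V) : measurable N -> sigma_circ R d N = 0%E ->
  P [set w | Defs.count X N w <> 0%N] = 0%E.
Proof.
move=> mN N0; rewrite (_ : mkset _ = ~` [set w | Defs.count X N w = 0%N])//.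
rewrite probability_setC; last exact: measurable_count_eq.
rewrite (poisson_law XP 0 mN) N0 /= mulr0 oppr0 expR0 expr0 fact0 divr1 mulr1.
by rewrite subee.
Qed.

Section partition.
Variables (I : finType) (Q : I -> set V).
Hypothesis mQ : forall i, measurable (Q i).
Hypothesis Q_disj : forall i j x, Q i x -> Q j x -> i = j.
Hypothesis Q_cover : forall x, sphere x -> exists i, Q i x.
Hypothesis Q_sphere : forall i x, Q i x -> sphere x.
Local Open Scope ereal_scope.

Lemma partition_sig : (\sum_i sig (Q i) = 1)%R.
Proof.
rewrite -sig_bigcup// (_ : \bigcup_i Q i = sphere) ?sigma_circ_sphere//.
apply/seteqP; split => [x [i _ /Q_sphere]//|x /Q_cover[i Qx]].
by exists i.
Qed.

Lemma sum_partition (s : seq V) (h : V -> \bar R) :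
  (forall x, x \in s -> sphere x) ->
  \sum_(x <- s) h x = \sum_i \sum_(x <- s | x \in Q i) h x.
Proof.
move=> sS; under [RHS]eq_bigr do rewrite big_mkcond.
rewrite exchange_big; apply: eq_big_seq => x xs /=.
have [i Qi] := Q_cover (sS _ xs).
rewrite (bigD1 i)//= mem_set// big1 ?adde0// => j ji.
rewrite ifF//; apply/negbTE; rewrite notin_setE => Qj.
by move: ji; rewrite (Q_disj Qi Qj) eqxx.
Qed.

Lemma sum_XE w (h : V -> \bar R) :
  \sum_(x \in X w) h x = \sum_i \sum_(x <- fset_set (X w) | x \in Q i) h x.
Proof.
rewrite fsbig_finite; last exact: poisson_finite XP w.
apply: sum_partition => x; rewrite in_fset_set; last exact: poisson_finite XP w.
by rewrite in_setE => /(poisson_sub XP).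
Qed.

Lemma sum_isolated w i x (h : V -> \bar R) : X w x -> Q i x ->
  (forall z, X w z -> Q i z -> z = x) ->
  \sum_(y <- fset_set (X w) | y \in Q i) h y = h x.
Proof.
move=> Xx Qx uniq_x; have fX := poisson_finite XP w.
rewrite big_mkcond (bigD1_seq x)//=; last 2 first.
- by rewrite in_fset_set// mem_set.
- exact: fset_uniq.
rewrite mem_set// big1_seq ?adde0// => y /andP[/eqP yx].
rewrite in_fset_set// in_setE => Xy; case: ifPn => //; rewrite in_setE => Qy.
by case: yx; exact: uniq_x.
Qed.

Hypothesis gamma0 : (0 < gamma)%R.
Variables (p : V) (kappa : R.-pker V ~> 'M[R]_d.+1) (E : set (set V)).
Hypothesis kappaP : rotation_kernel p kappa.
Let h (w : Om) x := cell_integral kappa E x (X w).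

Let h_ge0 w x : 0 <= h w x. Proof. exact: cell_integral_ge0. Qed.

Let sum_h_ge0 w : 0 <= \sum_(x \in X w) h w x.
Proof. by rewrite sum_XE; apply: sume_ge0 => i _; apply: sume_ge0. Qed.

Lemma typical_cell_probE :
  typical_cell_prob P X gamma kappa E = gamma^-1%:E * \int[P]_w \sum_(x \in X w) h w x.
Proof. by []. Qed.

Lemma measurable_sum_indic (J : finType) (F : J -> set Om) :
  (forall j, measurable (F j)) ->
  measurable_fun setT (fun w => \sum_j (\1_(F j) w)%:E : \bar R).
Proof.
by move=> mF; apply: emeasurable_sum => j; apply/measurable_EFinP; exact: measurable_indic.
Qed.

(* This lemma and the next one replace Mecke's formula. *)
Lemma typical_cell_prob_le (J : finType) (A : I -> J -> set V) (m : R) :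
  (forall i j, measurable (A i j)) -> (forall i j, m <= sig (A i j))%R ->
  (forall (Y : set V) i x psi, finite_set Y -> Y `<=` sphere -> Y x -> Q i x ->
     SO psi -> psi *m p = x ->
     E ([set invmx psi *m y | y in voronoi_cell x Y]) ->
     exists j, forall z, Y z -> Q i z \/ A i j z -> z = x) ->
  typical_cell_prob P X gamma kappa E <= (#|J|%:R * expR (- (gamma * m)))%:E.
Proof.
move=> mA mle hE.
have [N [mN N0 Ngood]] := good_center_ae kappaP.
(* Removing [Q i] makes the two sets disjoint, as independence of the counts requires. *)
pose F (i : I) (j : J) := isolated (Q i) (A i j `\` Q i).
have mF i j : measurable (F i j).
  by apply: measurable_isolated => //; exact: measurableD.
have intF : \int[P]_w (\sum_i \sum_j (\1_(F i j) w)%:E) =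
    \sum_i \sum_j P (F i j).
  rewrite ge0_integral_sum//; last 2 first.
  - by move=> i; exact: measurable_sum_indic.
  - by move=> i w _; apply: sume_ge0 => j _; rewrite lee_fin.
  apply: eq_bigr => i _; rewrite ge0_integral_sum//.
  - by apply: eq_bigr => j _; rewrite integral_indic ?setIT.
  by move=> j; apply/measurable_EFinP; exact: measurable_indic.
have PF i j : P (F i j) <= (gamma * sig (Q i) * expR (- (gamma * m)))%:E.
  rewrite isolated_prob//; [|exact: measurableD|exact: setDIK].
  rewrite lee_fin; apply: ler_wpM2l; first by rewrite mulr_ge0 ?sig_ge0 ?ltW.
  rewrite ler_expR lerN2 ler_pM2l//.
  apply: le_trans (mle i j) _.
  apply: (@le_trans _ _ (sig (Q i `|` A i j `\` Q i))).
    apply: sig_le => //; first by apply: measurableU => //; exact: measurableD.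
    by move=> z Az; have [Qz|Qz] := pselect (Q i z); [left|right].
  by apply: sig_leU => //; exact: measurableD.
(* Over the partition the factors [gamma * sig (Q i)] add up to [gamma], which [gamma^-1] cancels;
   each [j] costs one exponential. *)
apply: (@le_trans _ _ (gamma^-1%:E * \sum_i \sum_j P (F i j))); last first.
  apply: (@le_trans _ _ (gamma^-1%:E * \sum_i \sum_(j : J)
      (gamma * sig (Q i) * expR (- (gamma * m)))%:E)).
    apply: lee_wpmul2l; first by rewrite lee_fin invr_ge0 ltW.
    by apply: lee_sum => i _; apply: lee_sum.
  under eq_bigr do rewrite sumEFin.
  rewrite sumEFin -EFinM lee_fin.
  under eq_bigr do rewrite sumr_const -mulr_natl.
  rewrite -mulr_sumr -mulr_suml -mulr_sumr partition_sig mulr1.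
  by rewrite mulrCA (mulKf (lt0r_neq0 gamma0)).
rewrite typical_cell_probE; apply: lee_wpmul2l.
  by rewrite lee_fin invr_ge0 ltW.
rewrite -intF; apply: (integral_le_offnull (N := [set w | Defs.count X N w <> 0%N])).
- exact/measurableC/measurable_count_eq.
- exact: count0_null.
- by apply: emeasurable_sum => i; exact: measurable_sum_indic.
- exact: sum_h_ge0.
- by move=> w; do 2!apply: sume_ge0 => ? _; rewrite lee_fin.
move=> w /= /contrapT /count0P XN; rewrite sum_XE; apply: lee_sum => i _.
have F0 : 0 <= \sum_j (\1_(F i j) w)%:E :> \bar R.
  by apply: sume_ge0 => j _; rewrite lee_fin.
(* A nonzero term at [x] forces, through [hE], that [x] is the only nucleus in [Q i] and that some
   [F i j] occurs. So a piece contributes at most 1, and only on the union of these events. *)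
have [[x [Xx Qx hx]]|nex] := pselect (exists x, [/\ X w x, Q i x & h w x != 0]); last first.
  rewrite big1_seq// => y /andP[]; rewrite in_setE => Qy.
  rewrite in_fset_set ?in_setE; last exact: poisson_finite XP w.
  by move=> Xy; apply/eqP; apply: contra_notT nex => hy; exists y.
have gx : good_center p kappa x.
  by apply: Ngood; [exact: poisson_sub XP _ _ Xx|exact: XN].
have [psi [SOpsi psip Epsi]] := cell_integral_neq0 gx hx.
have [j Hj] := hE _ i x psi (poisson_finite XP w) (poisson_sub XP (w := w)) Xx Qx SOpsi psip Epsi.
rewrite (@sum_isolated w i x)//; last by move=> z Xz Qz; apply: Hj => //; left.
apply: le_trans (cell_integral_le1 _ _ _ _) _.
rewrite (bigD1 j)//= indicE mem_set ?leeDl//.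
  by apply: sume_ge0 => ? _; rewrite lee_fin.
split; first by apply/count1P; exists x; split => // z Xz Qz; apply: Hj => //; left.
apply/count0P => z Xz [Az nQz]; apply: nQz.
by rewrite (Hj z)//; right.
Qed.

Lemma typical_cell_prob_ge (A : I -> set V) (m : R) :
  (forall i, measurable (A i)) -> (forall i, sig (Q i `|` A i) <= m)%R ->
  (forall (Y : set V) i x psi, finite_set Y -> Y `<=` sphere -> Y x -> Q i x ->
     SO psi -> psi *m p = x ->
     (forall z, Y z -> Q i z \/ A i z -> z = x) ->
     E ([set invmx psi *m y | y in voronoi_cell x Y])) ->
  (expR (- (gamma * m)))%:E <= typical_cell_prob P X gamma kappa E.
Proof.
move=> mA mge hE.
have [N [mN N0 Ngood]] := good_center_ae kappaP.
pose F (i : I) := isolated (Q i) (A i `\` Q i).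
(* Deleting the null event [N'] ensures that every remaining nucleus is a good center and does not
   change the probability of [F i]. *)
pose N' := [set w | Defs.count X N w <> 0%N].
have mF i : measurable (F i).
  by apply: measurable_isolated => //; exact: measurableD.
have mN' : measurable N' by exact/measurableC/measurable_count_eq.
have mFN i : measurable (F i `\` N') by exact: measurableD.
have intF : \int[P]_w (\sum_i (\1_(F i `\` N') w)%:E) = \sum_i P (F i `\` N').
  rewrite ge0_integral_sum//.
  - by apply: eq_bigr => j _; rewrite integral_indic ?setIT.
  by move=> j; apply/measurable_EFinP; exact: measurable_indic.
have PF i : (gamma * sig (Q i) * expR (- (gamma * m)))%:E <= P (F i `\` N').
  apply: (@le_trans _ _ (P (F i))); last first.
    have -> : P (F i) = P (F i `\` N') + P (F i `&` N') by rewrite -measureDI.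
    rewrite [X in _ + X](_ : _ = 0) ?adde0//.
    by apply: (subset_measure0 _ _ _ (count0_null mN N0)) => //; exact: measurableI.
  rewrite isolated_prob//; [|exact: measurableD|exact: setDIK].
  rewrite lee_fin; apply: ler_wpM2l; first by rewrite mulr_ge0 ?sig_ge0 ?ltW.
  rewrite ler_expR lerN2 ler_pM2l//.
  apply: le_trans (mge i).
  rewrite -lee_fin EFinD !sigEFin//; [|exact: measurableU|exact: measurableD].
  rewrite -measureU//; [|exact: measurableD|exact: setDIK].
  by rewrite (_ : Q i `|` A i `\` Q i = Q i `|` A i)// setUDr setDv setD0.
rewrite typical_cell_probE.
apply: (@le_trans _ _ (gamma^-1%:E * \sum_i P (F i `\` N'))).
  apply: (@le_trans _ _ (gamma^-1%:E * \sum_i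
      (gamma * sig (Q i) * expR (- (gamma * m)))%:E)).
    rewrite sumEFin -EFinM lee_fin -mulr_suml -mulr_sumr partition_sig mulr1.
    by rewrite mulKf// gt_eqF.
  by apply: lee_wpmul2l; [rewrite lee_fin invr_ge0 ltW|exact: lee_sum].
apply: lee_wpmul2l; first by rewrite lee_fin invr_ge0 ltW.
rewrite -intF; apply: integral_le_nomeas.
  by move=> w; apply: sume_ge0 => ? _; rewrite lee_fin.
move=> w; rewrite sum_XE; apply: lee_sum => i _.
rewrite indicE; case: (boolP (w \in _)) => [|_]; last exact: sume_ge0.
rewrite in_setE => -[[/count1P[x [Xx Qx Hx]] /count0P A0] /contrapT /count0P XN].
rewrite (@sum_isolated w i x)//.
have gx : good_center p kappa x.
  by apply: Ngood; [exact: poisson_sub XP _ _ Xx|exact: XN].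
rewrite /h (cell_integral_eq1 gx)// => psi SOpsi psip.
apply: (hE (X w) i x psi) => //.
- exact: poisson_finite XP w.
- exact: poisson_sub XP w.
move=> z Xz [Qz|Az]; first exact: Hx.
have [Qz|nQz] := pselect (Q i z); first exact: Hx.
by have := A0 z Xz; case.
Qed.

End partition.
End poisson_counts.

(** * Voronoi cells *)

Section voronoi.
Variables (R : realType) (d : nat).
Local Notation V := ('cV[R]_d.+1).
Local Notation M := ('M[R]_d.+1).
Implicit Types (x y z p : V) (psi : M) (Y K : set V).

Lemma dotE_mx x y : dot x y = (x^T *m y) ord0 ord0.
Proof. by rewrite mxE; apply: eq_bigr => i _; rewrite mxE. Qed.

Lemma dot_SO psi x y : SO psi -> dot (psi *m x) (psi *m y) = dot x y.
Proof.
move=> [/mulmx1C psi1 _].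
by rewrite !dotE_mx trmx_mul mulmxA -(mulmxA _ _ psi) psi1 mulmx1.
Qed.

Lemma SO_unit psi : SO psi -> psi \in unitmx.
Proof. by move=> [_ det1]; rewrite unitmxE det1 unitr1. Qed.

Lemma sphere_SO psi x : SO psi -> sphere (psi *m x) <-> sphere x.
Proof. by move=> Spsi; rewrite /sphere /= dot_SO. Qed.

Lemma geo_dist_SO psi x y : SO psi ->
  geo_dist (psi *m x) (psi *m y) = geo_dist x y.
Proof. by move=> Spsi; rewrite /geo_dist dot_SO. Qed.

Lemma image_invmxE psi K x : SO psi ->
  [set invmx psi *m y | y in K] x <-> K (psi *m x).
Proof.
move=> Spsi; split => [[y Ky <-]|Kx].
  by rewrite mulmxA mulmxV ?mul1mx// SO_unit.
by exists (psi *m x) => //; rewrite mulmxA mulVmx ?mul1mx// SO_unit.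
Qed.

(* The point at signed distance [r] from [x] on the great circle from [x] to
   [z]; junk if [x] and [z] are parallel. *)
Definition geo_point x z (r : R) : V :=
  cos r *: x + (sin r / sin (geo_dist x z)) *: (z - cos (geo_dist x z) *: x).

Section geo_point.
Variables (x z : V) (r : R).
Hypotheses (Sx : sphere x) (Sz : sphere z) (xz : 0 < geo_dist x z < pi).

Let s_neq0 : sin (geo_dist x z) != 0.
Proof. by rewrite gt_eqF// sin_gt0_pi. Qed.

Lemma dot_geo_point_l : dot x (geo_point x z r) = cos r.
Proof. by rewrite /geo_point !dotE Sx (cos_geo_dist Sx Sz); ring. Qed.

Lemma dot_geo_point_r : dot z (geo_point x z r) = cos (geo_dist x z - r).
Proof.
rewrite cosB /geo_point !dotE Sz (dotC z x) (cos_geo_dist Sx Sz).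
have := sin2cos2 (geo_dist x z); rewrite (cos_geo_dist Sx Sz) => s2.
have -> : 1 - dot x z * dot x z = sin (geo_dist x z) ^+ 2 by rewrite s2 expr2.
by field.
Qed.

Lemma sphere_geo_point : sphere (geo_point x z r).
Proof.
rewrite /sphere /= {1}/geo_point dotDl !dotZl dotBl dotZl.
rewrite dot_geo_point_l dot_geo_point_r cosB (cos_geo_dist Sx Sz).
have := cos2Dsin2 r; move: (cos r) (sin r) => c s cs.
by rewrite -cs; field.
Qed.

Lemma geo_dist_geo_point_l : 0 <= r <= pi -> geo_dist x (geo_point x z r) = r.
Proof. by move=> r0; rewrite /geo_dist dot_geo_point_l cosK// in_itv. Qed.

Lemma geo_dist_geo_point_r : 0 <= r <= pi ->
  geo_dist z (geo_point x z r) = `|geo_dist x z - r|.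
Proof.
move=> /andP[r0 rpi]; rewrite /geo_dist dot_geo_point_r -cos_norm cosK// in_itv/=.
by rewrite normr_ge0/= ler_norml; case/andP: xz => ? ?; apply/andP; split; lra.
Qed.

End geo_point.

(** In this form the cell is cut out by linear inequalities, from which its convexity is read off
    later. *)
Lemma voronoi_dot x Y y : sphere x -> Y `<=` sphere -> sphere y ->
  voronoi_cell x Y y <-> forall z, Y z -> dot y z <= dot y x.
Proof.
move=> Sx SY Sy; split => [[_ h] z Yz|h].
  have Sz := SY _ Yz; rewrite -(cos_geo_dist Sy Sz).
  by rewrite -geo_dist_le ?geo_dist_itv//; exact: h.
split => // z Yz; have Sz := SY _ Yz.
by rewrite geo_dist_le ?geo_dist_itv// cos_geo_dist// h.
Qed.

Lemma inradius_ge p K a : 0 <= a <= pi -> geo_ball p a `<=` K -> a <= inradius p K.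
Proof.
move=> a0pi aK; apply: sup_upper_bound; last by split.
split; first by exists a; split.
by exists pi => r [/andP[]].
Qed.

(** Strictness of [r < a] replaces an argument that the supremum is attained. *)
Lemma inradius_ball p K a r : a <= inradius p K -> 0 <= r < a -> geo_ball p r `<=` K.
Proof.
move=> aK /andP[r0 ra].
have [E0|E0] := pselect ([set r | 0 <= r <= pi /\ geo_ball p r `<=` K] !=set0); last first.
  (* The supremum of the empty set is 0, which contradicts [0 <= r < a]. *)
  exfalso; move: aK; rewrite /inradius sup_out; last by case.
  by rewrite leNgt (le_lt_trans r0 ra).
have hs : has_sup [set r | 0 <= r <= pi /\ geo_ball p r `<=` K].
  by split => //; exists pi => s [/andP[]].
have ar : 0 < a - r by rewrite subr_gt0.
have [s [_ sK] rs] := sup_adherent ar hs.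
apply: subset_trans sK; apply: geo_ball_subW; apply/ltW/(le_lt_trans _ rs).
rewrite -/(inradius p K); lra.
Qed.

Lemma circumradius_le p K t : 0 <= t -> K `<=` geo_ball p t -> circumradius p K <= t.
Proof.
by move=> t0 Kt; apply: ge_inf; [exists 0 => r []|split].
Qed.

Section cell.
Variables (p x : V) (psi : M) (Y : set V).
Hypotheses (Sx : sphere x) (SO_psi : SO psi).
Hypotheses (psi_p : psi *m p = x) (SY : Y `<=` sphere).
Let K := [set invmx psi *m y | y in voronoi_cell x Y].

Lemma geo_ball_rotated r :
  geo_ball p r `<=` K <-> geo_ball x r `<=` voronoi_cell x Y.
Proof.
split=> [sub y [Sy yr]|sub y [Sy yr]].
  have yE : psi *m (invmx psi *m y) = y by rewrite mulmxA mulmxV ?mul1mx// SO_unit.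
  rewrite -yE; apply/image_invmxE => //; apply: sub; split.
    by rewrite -(sphere_SO _ SO_psi) yE.
  by rewrite -(geo_dist_SO p _ SO_psi) yE psi_p.
apply/image_invmxE => //; apply: sub; split; first by rewrite sphere_SO.
by rewrite -psi_p geo_dist_SO.
Qed.

Lemma inradius_cell_ge a : 0 < a < pi / 2 ->
  a <= inradius p K -> forall z, Y z -> z = x \/ 2 * a <= geo_dist x z.
Proof.
move=> /andP[a0 api] aK z Yz; have Sz := SY Yz.
have /andP[D0 Dpi] := geo_dist_itv Sx Sz.
have [D_eq0|D_neq0] := eqVneq (geo_dist x z) 0.
  left; apply/esym/subr0_eq/dot_eq0; rewrite !dotE Sx Sz (dotC z x).
  by rewrite -(cos_geo_dist Sx Sz) D_eq0 cos0; ring.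
have {}D0 : 0 < geo_dist x z by rewrite lt_def D_neq0.
right; rewrite leNgt; apply/negP => Da.
(* Strictly between half the distance to [z] and [a]: the point at distance [r] from [x] towards [z]
   is nearer to [z], yet belongs to the cell. *)
pose r := (geo_dist x z / 2 + a) / 2.
have r0 : 0 <= r < a by apply/andP; rewrite /r; split; lra.
have /geo_ball_rotated rC := inradius_ball aK r0.
have xz : 0 < geo_dist x z < pi by apply/andP; split; lra.
have [_ /(_ _ Yz)] : voronoi_cell x Y (geo_point x z r).
  apply: rC; split; first exact: sphere_geo_point.
  by rewrite geo_dist_geo_point_l//; apply/andP; case/andP: r0 => ? ?; split; lra.
have r0pi : 0 <= r <= pi by apply/andP; case/andP: r0 => ? ?; split; lra.
rewrite geo_distC geo_dist_geo_point_l// geo_distC geo_dist_geo_point_r//.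
rewrite leNgt => /negP; apply; rewrite ltr_norml.
by apply/andP; rewrite /r; split; lra.
Qed.

Lemma inradius_cell_le a : 0 < a < pi / 2 ->
  (forall z, Y z -> z = x \/ 2 * a <= geo_dist x z) -> a <= inradius p K.
Proof.
move=> /andP[a0 api] h; apply: inradius_ge; first by apply/andP; split; lra.
apply/geo_ball_rotated => y [Sy ya]; split => // z Yz.
have [->//|az] := h z Yz.
have := geo_dist_triangle Sx Sy (SY Yz); rewrite (geo_distC y x); lra.
Qed.

(** The circumradius is at least [a + eps], so the cell has a point [z] beyond distance [t] from
    [x]. The point at distance [t] on the geodesic from [x] to [z] is a nonnegative combination of
    [x] and [z], hence satisfies the linear inequalities of the cell; for it they say that no
    nucleus is closer than [t]. *)
Lemma far_point_in_cell (a eps t : R) : 0 < t < pi / 2 -> t < a + eps ->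
  a <= inradius p K -> bodies_at p K -> eps <= vartheta p K ->
  exists y, [/\ sphere y, geo_dist x y = t & forall z, Y z -> t <= geo_dist y z].
Proof.
move=> /andP[t0 tpi] ta aK [_ _ Kpi] epsK.
have : exists y0, K y0 /\ ~ geo_dist p y0 <= t.
  apply: contrapT => h; move: epsK; rewrite /vartheta => epsK.
  have : circumradius p K <= t.
    apply: circumradius_le => [|y Ky]; first exact: ltW.
    split; first by have [] := Kpi y Ky.
    by apply: contrapT => yt; apply: h; exists y.
  by move: (circumradius p K) (inradius p K) aK epsK => u v; lra.
move=> [y0 [Ky0 /negP]]; rewrite -ltNge => ty0.
have [Sy0 Dpi] := Kpi y0 Ky0.
have zC : voronoi_cell x Y (psi *m y0) by exact/image_invmxE.
have Sz : sphere (psi *m y0) by exact/sphere_SO.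
have DE : geo_dist x (psi *m y0) = geo_dist p y0 by rewrite -psi_p geo_dist_SO.
move: (psi *m y0) zC Sz DE => z zC Sz DE.
have xz : 0 < geo_dist x z < pi by apply/andP; rewrite DE; split; lra.
have t0pi : 0 <= t <= pi by apply/andP; split; lra.
have Sy := sphere_geo_point t Sx Sz xz.
have dt := geo_dist_geo_point_l Sx Sz t0pi.
exists (geo_point x z t); split => //.
suff [_ yC] : voronoi_cell x Y (geo_point x z t).
  by move=> w /yC; rewrite (geo_distC _ x) dt.
apply/voronoi_dot => // w Yw.
have zw : dot z w <= dot z x by move/(voronoi_dot Sx SY Sz): zC; exact.
have xw : dot x w <= dot x x.
  by rewrite Sx; have /andP[] := dot_unit_le1 Sx (SY Yw).
have s0 : 0 < sin (geo_dist x z) by rewrite sin_gt0_pi.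
have -> : geo_point x z t = (sin (geo_dist x z - t) / sin (geo_dist x z)) *: x +
    (sin t / sin (geo_dist x z)) *: z.
  apply/matrixP => i j; rewrite /geo_point !mxE sinB; field; exact: lt0r_neq0.
rewrite !dotE lerD// ler_wpM2l// divr_ge0 ?ltW ?sin_gt0_pi//.
  by rewrite DE; apply/andP; split; lra.
by apply/andP; split; lra.
Qed.

End cell.
End voronoi.

(** * Probability estimates for the inradius and for [vartheta] *)

Section cell_probabilities.
Variables (R : realType) (d : nat).
Local Notation V := ('cV[R]_d.+1).
Local Notation sig A := (fine (sigma_circ R d A)).
Implicit Types (x y z p : V).

Lemma geo_ball_shell p (th r : R) :
  geo_ball p th `<=` geo_ball p (th - r) `|` shell p th r.
Proof.
move=> y [Sy yth]; have [h|h] := leP (geo_dist p y) (th - r); first by left; split.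
have [r0|r0] := leP 0 r.
  by right; split; [split => //; lra|move=> [_]; lra].
by left; split => //; lra.
Qed.

Lemma geo_ball_shellS p (th r : R) :
  geo_ball p (th + r) `<=` geo_ball p th `|` shell p th r.
Proof.
move=> y [Sy yth]; have [h|h] := leP (geo_dist p y) th; first by left; split.
by right; split; [split|move=> [_]; lra].
Qed.

Lemma shell_sub p (th r s : R) : r <= s -> shell p th r `<=` shell p th s.
Proof.
move=> rs y [[Sy h1] h2]; split; first by split => //; lra.
by move=> [_ h]; apply: h2; split => //; lra.
Qed.

Lemma sig_setT : sig [set: V] = 1.
Proof. by rewrite probability_setT. Qed.

Lemma sig_le1 (A : set V) : measurable A -> sig A <= 1.
Proof. by move=> mA; rewrite -sig_setT sig_le. Qed.

Lemma cap_approx p (th eta : R) : sphere p -> 0 < th < pi -> 0 < eta ->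
  exists2 r, 0 < r & forall s, s <= r ->
    sig (geo_ball p (th + s)) <= sig (geo_ball p th) + eta /\
    sig (shell p th s) <= eta.
Proof.
move=> Sp thpi eta0; have [r r0 hr] := shell_small Sp thpi eta0.
exists r => // s sr.
have hs : sig (shell p th s) <= eta.
  apply: le_trans hr; apply: sig_le; [exact: measurable_shell..|exact: shell_sub].
split => //.
apply: (@le_trans _ _ (sig (geo_ball p th `|` shell p th s))).
  apply: sig_le; last exact: geo_ball_shellS.
    exact: measurable_geo_ball.
  by apply: measurableU; [exact: measurable_geo_ball|exact: measurable_shell].
apply: le_trans (sig_leU _ _) _.
- exact: measurable_geo_ball.
- exact: measurable_shell.
by rewrite lerD2l.
Qed.

Section inradius.
Variables (p : V) (a : R).
Hypotheses (Sp : sphere p) (api : 0 < a < pi / 2).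
Let rho := sig (geo_ball p (2 * a)).
Let a2pi : 0 < 2 * a < pi. Proof. by case/andP: api => ? ?; apply/andP; split; lra. Qed.

Lemma prob_inradius_bounds eta gamma Q : 0 < eta -> 0 < gamma ->
  typical_cell_law p gamma Q ->
  ((expR (- (gamma * (rho + eta))))%:E <= Q [set K | (a <= inradius p K)%R])%E /\
  (Q [set K | (a <= inradius p K)%R] <= (expR (- (gamma * (rho - eta))))%:E)%E.
Proof.
move=> eta0 gamma0 [dO [Om [P [X [kappa [XP kappaP ->]]]]]].
have [a0 api2] := andP api.
have [r0 r00 hr0] := cap_approx Sp a2pi eta0.
pose r := Num.min (r0 / 2) (a / 2).
have r_gt0 : 0 < r by rewrite lt_min !divr_gt0.
have rr0 : 2 * r <= r0 by rewrite mulrC -ler_pdivlMr// ge_min lexx.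
have ra : r < a by rewrite gt_min; apply/orP; right; lra.
have [I [W [q [mW W_disj W_cover Sq Wq]]]] := sphere_partition d r_gt0.
have W_sphere i x : W i x -> sphere x by case/Wq.
split.
  apply: (typical_cell_prob_ge XP mW W_disj W_cover W_sphere gamma0 kappaP
    (A := fun i => geo_ball (q i) (2 * a + r))).
  - by move=> i; exact: measurable_geo_ball.
  - move=> i; rewrite setUidr; last first.
      move=> x /Wq[Sx xr]; split => //; lra.
    rewrite (sigma_circ_geo_ball _ (Sq i) Sp).
    have rr : r <= r0 by lra.
    by have [] := hr0 _ rr.
  move=> Y i x psi fY SY Yx Wx SOpsi psip uniq_x /=.
  have [Sx dqx] := Wq _ _ Wx.
  apply: (inradius_cell_le Sx SOpsi psip SY api) => z Yz.
  have [h|h] := leP (geo_dist (q i) z) (2 * a + r).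
    by left; apply: uniq_x => //; right; split => //; exact: SY.
  right; have := geo_dist_triangle (Sq i) Sx (SY _ Yz); lra.
(* One [r] accounts for the distance from [x] to [q i]; the second makes the distance from [x] to a
   nucleus in the reduced ball strictly smaller than [2 * a]. *)
have := typical_cell_prob_le XP mW W_disj W_cover W_sphere gamma0 kappaP
  (E := [set K | a <= inradius p K]) (m := rho - eta)
  (A := fun i (_ : unit) => geo_ball (q i) (2 * a - 2 * r)).
rewrite card_unit mul1r; apply.
- by move=> i _; exact: measurable_geo_ball.
- move=> i _; rewrite (sigma_circ_geo_ball _ (Sq i) Sp) lerBlDr.
  apply: (@le_trans _ _ (sig (geo_ball p (2 * a - 2 * r) `|` shell p (2 * a) (2 * r)))).
    apply: sig_le; last exact: geo_ball_shell.
      exact: measurable_geo_ball.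
    by apply: measurableU; [exact: measurable_geo_ball|exact: measurable_shell].
  apply: le_trans (sig_leU _ _) _.
  - exact: measurable_geo_ball.
  - exact: measurable_shell.
  by rewrite lerD2l; have [] := hr0 _ rr0.
move=> Y i x psi fY SY Yx Wx SOpsi psip /= aK; exists tt => z Yz zW.
have [Sx dqx] := Wq _ _ Wx; have Sz := SY _ Yz.
have [//|az] := inradius_cell_ge Sx SOpsi psip SY api aK Yz.
exfalso; have := geo_dist_triangle Sx (Sq i) Sz; rewrite (geo_distC x (q i)).
by case: zW => [/Wq[_]|[_]]; lra.
Qed.

Lemma prob_inradius gamma Q : 0 < gamma -> typical_cell_law p gamma Q ->
  Q [set K | a <= inradius p K] = (expR (- (gamma * rho)))%:E.
Proof.
move=> gamma0 QP.
have H eta : 0 < eta -> _ := fun e0 => prob_inradius_bounds e0 gamma0 QP.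
move: (Q _) H => [x||] H; last 2 first.
- by have [_] := H 1 ltr01; rewrite leye_eq.
- by have [] := H 1 ltr01; rewrite leeNy_eq.
have x0 : 0 < x by have [+ _] := H 1 ltr01; rewrite lee_fin; apply: lt_le_trans; exact: expR_gt0.
congr EFin; rewrite -[LHS]lnK ?posrE//; congr expR.
apply/eqP; rewrite eq_le; apply/andP; split; apply/(@ler_addgt0Pl R) => e e0;
  have eg : 0 < e / gamma by rewrite divr_gt0.
  have [_] := H _ eg; rewrite lee_fin -ler_ln ?posrE ?expR_gt0// expRK => /le_trans; apply.
  by rewrite mulrBr mulrCA divff ?gt_eqF// mulr1 opprB lexx.
have [+ _] := H _ eg; rewrite lee_fin -ler_ln ?posrE ?expR_gt0// expRK.
by rewrite mulrDr mulrCA divff ?gt_eqF// mulr1; lra.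
Qed.

End inradius.

Lemma prob_theta_bound p y0 (a eps t eta : R) : sphere p -> sphere y0 ->
  0 < a < pi / 2 -> 0 < t < pi / 2 -> t < a + eps -> geo_dist p y0 = t ->
  0 < eta ->
  exists2 C : R, 0 < C & forall (gamma : R) Q, 0 < gamma -> typical_cell_law p gamma Q ->
    (Q ([set K : set V | bodies_at p K /\ (eps <= vartheta p K)%R] `&`
        [set K | (a <= inradius p K)%R]) <=
     (C * expR (- (gamma *
       (sig (geo_ball p (2 * a) `|` geo_ball y0 t) - eta))))%:E)%E.
Proof.
move=> Sp Sy0 api tpi ta dy0 eta0.
have [a0 api2] := andP api; have [t0 tpi2] := andP tpi.
have eta2 : 0 < eta / 2 by rewrite divr_gt0.
have a2pi : 0 < 2 * a < pi by apply/andP; split; lra.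
have t_pi : 0 < t < pi by apply/andP; split; lra.
have [r1 r10 hr1] := cap_approx Sp a2pi eta2.
have [r2 r20 hr2] := cap_approx Sy0 t_pi eta2.
pose r := Num.min (Num.min r1 r2) (Num.min a t) / 8.
have r_gt0 : 0 < r by rewrite divr_gt0// !lt_min r10 r20 a0 t0.
have r8 : 8 * r = Num.min (Num.min r1 r2) (Num.min a t) by rewrite /r; field.
have rr1 : 4 * r <= r1.
  by apply: (@le_trans _ _ (8 * r)); [lra|rewrite r8 !ge_min lexx].
have rr2 : 4 * r <= r2.
  by apply: (@le_trans _ _ (8 * r)); [lra|rewrite r8 !ge_min lexx orbT].
have ra : 8 * r <= a by rewrite r8 !ge_min lexx !orbT.
have rt : 8 * r <= t by rewrite r8 !ge_min lexx !orbT.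
clear r8; move: r r_gt0 rr1 rr2 ra rt => r r_gt0 rr1 rr2 ra rt.
have [I [W [q [mW W_disj W_cover Sq Wq]]]] := sphere_partition d r_gt0.
have W_sphere i x : W i x -> sphere x by case/Wq.
have [i0 _] := W_cover _ Sp.
(* The index [j] records the piece containing the far point. The partition is fixed before [gamma],
   so this constant does not depend on it. *)
exists #|I|%:R; first by rewrite ltr0n; apply/card_gt0P; exists i0.
move=> gamma Q gamma0 [dO [Om [P [X [kappa [XP kappaP ->]]]]]].
pose close i j := `|geo_dist (q i) (q j) - t| <= 2 * r.
(* Only pairs at distance about [t] matter; for the others the whole space
   keeps the lower bound on the measure. *)
pose A i j := if close i j then
  geo_ball (q i) (2 * a - 2 * r) `|` geo_ball (q j) (t - 2 * r) else [set: V].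
have mU x y u v : sphere x -> sphere y -> measurable (geo_ball x u `|` geo_ball y v).
  by move=> Sx Sy; apply: measurableU; exact: measurable_geo_ball.
apply: (typical_cell_prob_le XP mW W_disj W_cover W_sphere gamma0 kappaP (A := A)).
- by move=> i j; rewrite /A; case: ifP => // _; exact: mU.
- move=> i j; rewrite /A; case: ifPn => [cij|_]; last first.
    by rewrite sig_setT; have := sig_le1 (mU p y0 (2 * a) t Sp Sy0); lra.
  move: cij; rewrite /close ler_norml => /andP[c1 c2].
  have Dpi : 0 < geo_dist (q i) (q j) < pi by apply/andP; split; lra.
  have tpi' : 0 <= t <= pi by apply/andP; split; lra.
  (* Since [q j] is only roughly at distance [t] from [q i], it is moved along the geodesic to
     distance exactly [t]. The new pair is congruent to [(p, y0)], at the price of [2 * r] in the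
     radius. *)
  have Sy := sphere_geo_point t (Sq i) (Sq j) Dpi.
  have dl := geo_dist_geo_point_l (Sq i) (Sq j) tpi'.
  have dr : geo_dist (q j) (geo_point (q i) (q j) t) <= 2 * r.
    by rewrite (geo_dist_geo_point_r (Sq i) (Sq j) Dpi tpi') ler_norml; apply/andP.
  move: (geo_point _ _ _) Sy dl dr => y Sy dl dr.
  rewrite lerBlDr.
  apply: (@le_trans _ _ (sig ((geo_ball p (2 * a - 4 * r) `|` geo_ball y0 (t - 4 * r))
     `|` (shell p (2 * a) (4 * r) `|` shell y0 t (4 * r))))).
    apply: sig_le.
    - exact: mU.
    - apply: measurableU; first exact: mU.
      by apply: measurableU; exact: measurable_shell.
    rewrite setUACA; apply: setUSS; exact: geo_ball_shell.
  apply: le_trans (sig_leU _ _) _.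
  - exact: mU.
  - by apply: measurableU; exact: measurable_shell.
  apply: lerD; last first.
    apply: le_trans (sig_leU _ _) _; [exact: measurable_shell..|].
    have [_ h1] := hr1 _ rr1; have [_ h2] := hr2 _ rr2; lra.
  rewrite (sigma_circ_balls _ _ Sp Sy0 (Sq i) Sy); last first.
    by rewrite -(cos_geo_dist Sp Sy0) -(cos_geo_dist (Sq i) Sy) dy0 dl.
  apply: sig_le; [exact: mU..|].
  apply: setUSS; first by apply: geo_ball_subW; lra.
  move=> z [Sz dz]; split => //.
  have := geo_dist_triangle (Sq j) Sy Sz; lra.
move=> Y i x psi fY SY Yx Wx SOpsi psip [[bK eK] aK].
have [Sx dqx] := Wq _ _ Wx.
have [y [Sy xy yY]] := far_point_in_cell Sx SOpsi psip SY tpi ta aK bK eK.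
have [j Wy] := W_cover _ Sy; exists j => z Yz zW.
have [_ dqy] := Wq _ _ Wy; have Sz := SY _ Yz.
have [//|az] := inradius_cell_ge Sx SOpsi psip SY api aK Yz.
exfalso.
have h1 := geo_dist_triangle Sx (Sq i) Sz; rewrite (geo_distC x (q i)) in h1.
have h2 := geo_dist_triangle Sy (Sq j) Sz; rewrite (geo_distC y (q j)) in h2.
have h3 := yY _ Yz.
case: zW => [/Wq[_ h4]|]; first by lra.
have c_ij : close i j.
  have h5 := geo_dist_triangle (Sq i) Sx (Sq j).
  have h6 := geo_dist_triangle Sx Sy (Sq j); rewrite (geo_distC y (q j)) in h6.
  have h7 := geo_dist_triangle Sx (Sq i) Sy; rewrite (geo_distC x (q i)) in h7.
  have h8 := geo_dist_triangle (Sq i) (Sq j) Sy.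
  by rewrite /close ler_norml; apply/andP; split; lra.
rewrite /A c_ij => -[[_ ?]|[_ ?]]; lra.
Qed.

End cell_probabilities.

(** * The hull of a cap and a point *)

Section test_body.
Variables (R : realType) (d : nat).
Local Notation V := ('cV[R]_d.+1).
Local Notation sigma := (sigma_circ R d).
Implicit Types (x y z p u v w : V) (K A : set V).

Lemma dot_continuous x : continuous (dot x : V -> R).
Proof.
have h (s : seq 'I_d.+1) : continuous (fun v : V => \sum_(i <- s) x i ord0 * v i ord0).
  elim: s => [|i s IH] v.
    under eq_fun do rewrite big_nil.
    exact: cst_continuous.
  under eq_fun do rewrite big_cons.
  apply: cvgD; [exact: (nbhs_filter v)| |exact: IH].
  apply: cvgM; [exact: (nbhs_filter v)| |exact: coord_continuous].
  by apply: cvg_cst; exact: (nbhs_filter v).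
exact: h.
Qed.

Lemma dot_geo_points x z (r s : R) : sphere x -> sphere z -> 0 < geo_dist x z < pi ->
  dot (geo_point x z r) (geo_point x z s) = cos (r - s).
Proof.
move=> Sx Sz xz; have s0 : sin (geo_dist x z) != 0 by rewrite gt_eqF// sin_gt0_pi.
rewrite {1}/geo_point dotDl !dotZl dotBl dotZl.
rewrite (dot_geo_point_l _ Sx Sz)// (dot_geo_point_r _ Sx Sz xz) !cosB.
by field.
Qed.

Definition polar A : set V := [set w | forall u, A u -> dot u w <= 0].

Lemma bipolar_sub A : A `<=` polar (polar A).
Proof. by move=> u Au w Aw; rewrite dotC; exact: Aw. Qed.

Lemma closed_convex_cone_polar A : closed_convex_cone (polar A).
Proof.
split.
- by exists 0 => u _; rewrite dotC dot0l.
- rewrite (_ : polar A = \bigcap_(u in A) (dot u @^-1` [set r : R | r <= 0])).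
    apply: closed_bigI => u _; apply: preimage_closed; last exact: closed_le.
    by move=> v _; exact: dot_continuous.
  by apply/seteqP; split => w h u; exact: h.
- by move=> t v t0 Av u Au; rewrite dotZr mulr_ge0_le0// Av.
- move=> v w l; rewrite !in_setE => Av Aw u Au.
  rewrite [X in dot u X](_ : _ = l%:num *: v + (1 - l%:num) *: w)// dotDr !dotZr.
  have := Av u Au; have := Aw u Au.
  have : 0 <= l%:num by []. have : l%:num <= 1 by [].
  move: (l%:num) (dot u v) (dot u w) => k a b *; nra.
Qed.

(** A measurable superset of the hitting set is enough, by monotonicity of the integral alone. *)
Lemma Utilde_le p K A : measurable A ->
  (forall z v, sphere z -> K v -> dot (z - p) v = 0 -> A z) ->
  (Utilde p K <= sigma A)%E.
Proof.
move=> mA h; rewrite /Utilde integral_mkcond.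
apply: (@le_trans _ _ (\int[sigma]_z (\1_A z)%:E)%E); last by rewrite integral_indic ?setIT.
apply: integral_le_nomeas => z; rewrite patchE; case: ifPn => [|_]; rewrite ?lee_fin//.
rewrite in_setE => Sz; rewrite !indicE.
case: (boolP (z \in [set _ | _])) => //; rewrite in_setE => -[v [zv Kv]].
by rewrite mem_set//; exact: h zv.
Qed.

Lemma Utilde_ge p K A : measurable A ->
  (forall z, A z -> sphere z /\ exists2 v, K v & dot (z - p) v = 0) ->
  (sigma A <= Utilde p K)%E.
Proof.
move=> mA h; rewrite /Utilde [leRHS]integral_mkcond.
apply: (@le_trans _ _ (\int[sigma]_z (\1_A z)%:E)%E); first by rewrite integral_indic ?setIT.
apply: integral_le_nomeas => z; first by rewrite lee_fin.
rewrite patchE indicE; case: (boolP (z \in A)) => [|_].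
  rewrite in_setE => /h[Sz [v Kv zv]]; rewrite mem_set// indicE mem_set//.
  by exists v.
by case: ifPn => //; rewrite lee_fin.
Qed.

(** The midpoint of the geodesic from [p] to [z] is orthogonal to [z - p], and lies within [a] of
    [p] when [z] lies within [2 * a]. *)
Lemma Utilde_geo_ball p (a : R) : sphere p -> 0 < a < pi / 2 ->
  (sigma (geo_ball p (2 * a)) <= Utilde p (geo_ball p a))%E.
Proof.
move=> Sp /andP[a0 api]; apply: Utilde_ge; first exact: measurable_geo_ball.
move=> z [Sz]; rewrite geo_dist_le//; last by apply/andP; split; lra.
rewrite mulr_natl cos_mulr2n => zp; split => //.
have ca : 0 < cos a by rewrite cos_gt0_pihalf//; apply/andP; split; lra.
set c := cos a in zp ca *.
(* The norm of [z + p]; its half is the cosine of the distance from [p] to the midpoint. *)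
pose q := Num.sqrt (2 + 2 * dot p z).
have q0 : 0 <= q by exact: sqrtr_ge0.
have q2 : q ^+ 2 = 2 + 2 * dot p z.
  by rewrite sqr_sqrtr//; move: zp; rewrite mulr2n; nra.
have qc : 2 * c <= q by move: zp; rewrite mulr2n; nra.
have qn0 : q != 0 by rewrite gt_eqF//; lra.
exists (q^-1 *: (z + p)); last by rewrite !dotE Sz Sp (dotC z p); ring.
have Sv : sphere (q^-1 *: (z + p)).
  rewrite /sphere /= !dotE Sz Sp (dotC z p).
  transitivity (q^-1 ^+ 2 * (2 + 2 * dot p z)); first by ring.
  by rewrite -q2; field.
have pv : dot p (q^-1 *: (z + p)) = q / 2.
  rewrite !dotE Sp (_ : dot p z = (q ^+ 2 - 2) / 2); last by rewrite q2; field.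
  by field.
by split => //; rewrite geo_dist_le ?pv//; [rewrite -/c; lra|apply/andP; split; lra].
Qed.

Section cap_and_point.
Variables (p y0 : V) (a t : R).
Hypotheses (Sp : sphere p) (Sy0 : sphere y0).
Hypotheses (atpi : [/\ 0 < a, a < t & t < pi / 2]) (dy0 : geo_dist p y0 = t).

(* The spherical hull of [gens] is written as a bipolar, which makes it closed
   by construction. *)
Let gens := geo_ball p a `|` [set y0].
Let W := polar gens.
Let K := sphere `&` polar W.

Let api : 0 <= a <= pi. Proof. by case: atpi => *; apply/andP; split; lra. Qed.
Let t_pi : 0 <= t <= pi. Proof. by case: atpi => *; apply/andP; split; lra. Qed.
Let xz : 0 < geo_dist p y0 < pi. Proof. by case: atpi => *; rewrite dy0; apply/andP; split; lra. Qed.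

Let ct0 : 0 < cos t.
Proof.
have [a0 at_ tpi] := atpi.
by rewrite cos_gt0_pihalf//; apply/andP; split; lra.
Qed.

Let gens_sphere u : gens u -> sphere u.
Proof. by case=> [[]|->]. Qed.

Let gens_dot u : gens u -> cos t <= dot u p.
Proof.
have [a0 at_ tpi] := atpi.
case=> [[Su ua]|->]; last by rewrite dotC -(cos_geo_dist Sp Sy0) dy0.
by rewrite dotC -geo_dist_le//; lra.
Qed.

Let p_gens : gens p.
Proof. have [a0 at_ tpi] := atpi.
by left; split => //; rewrite geo_distxx// ltW. Qed.

(** Each generator [u] satisfies [dot u v <= 1] and [cos t <= dot u p], so [cos t *: v - p] belongs
    to [W]; pairing it with [v] gives the bound. *)
Let body_dot v : K v -> cos t <= dot v p.
Proof.
move=> [Sv Cv]; have : dot v (cos t *: v - p) <= 0.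
  rewrite dotC; apply: Cv => u Gu; rewrite dotBr dotZr.
  have := gens_dot Gu; have /andP[_] := dot_unit_le1 (gens_sphere Gu) Sv.
  by have := ct0; nra.
by rewrite dotBr dotZr Sv; lra.
Qed.

(** The uniform gap [e] on the generators leaves room to add [e *: p] to [w] within [W], and
    [dot v p] is positive on the body. *)
Let body_strict w e : 0 < e -> (forall u, gens u -> dot u w <= - e) ->
  forall v, K v -> dot v w < 0.
Proof.
move=> e0 we v Kv; have [Sv Cv] := Kv.
have : dot (w + e *: p) v <= 0.
  apply: Cv => u Gu; rewrite dotDr dotZr.
  have := we u Gu; have /andP[_] := dot_unit_le1 (gens_sphere Gu) Sp; nra.
by rewrite dotDl dotZl !(dotC _ v); have := body_dot Kv; have := ct0; nra.
Qed.

Let body_at : bodies_at p K.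
Proof.
have [a0 at_ tpi] := atpi.
split.
- exists (polar W); split => //; first exact: closed_convex_cone_polar.
  move=> [U UE]; have Up : p \in U.
    by have : polar W p by [exact: bipolar_sub]; rewrite UE.
  have : K (- p).
    split; first by rewrite /sphere /= dotNl dotNr opprK.
    by rewrite UE /= memvN.
  by move=> /body_dot; rewrite dotNl Sp; have := ct0; lra.
- by split => //; exact: bipolar_sub.
- move=> v Kv; have [Sv _] := Kv; split => //.
  rewrite geo_dist_le// ?cos_pihalf; last by apply/andP; split; lra.
  by rewrite dotC (le_trans (ltW ct0))// body_dot.
Qed.

Let gens_body u : gens u -> K u.
Proof. by move=> Gu; split; [exact: gens_sphere|exact: bipolar_sub]. Qed.

(* The halfspace orthogonal to the geodesic point at signed distance
   [- (a + pi / 2)] touches the cap opposite to [y0]. *)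
Let inradius_body_le : inradius p K <= a.
Proof.
have [a0 at_ tpi] := atpi.
apply: sup_le_ub.
  by exists 0; split; [rewrite lexx pi_ge0|move=> y [Sy h];
    apply: gens_body; left; split => //; lra].
move=> r [/andP[r0 rpi] rK]; rewrite leNgt; apply/negP => ar.
(* Capping at [pi / 2] keeps the angle [a + pi / 2 - s] between the two points used below strictly
   between 0 and [pi / 2], where the cosine is positive. *)
pose s := Num.min r (pi / 2).
have sr : s <= r by rewrite ge_min lexx.
have spi : s <= pi / 2 by rewrite ge_min lexx orbT.
have as_ : a < s by rewrite lt_min ar; lra.
have Sw := sphere_geo_point (- (a + pi / 2)) Sp Sy0 xz.
have Sv := sphere_geo_point (- s) Sp Sy0 xz.
have dneg b : 0 <= b <= pi -> geo_dist p (geo_point p y0 (- b)) = b.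
  move=> bpi; rewrite /geo_dist dot_geo_point_l// cosN cosK// in_itv.
have [_ Cv] : K (geo_point p y0 (- s)).
  by apply: rK; split => //; rewrite dneg//; apply/andP; split; lra.
have : dot (geo_point p y0 (- (a + pi / 2))) (geo_point p y0 (- s)) <= 0.
  apply: Cv => u [[Su ua]|->].
    have dw : geo_dist p (geo_point p y0 (- (a + pi / 2))) = a + pi / 2.
      by apply: dneg; apply/andP; split; lra.
    have := geo_dist_triangle Sp Su Sw; rewrite dw => h.
    rewrite -cos_pihalf -geo_dist_ge//; first lra.
    by apply/andP; split; lra.
  rewrite dot_geo_point_r// dy0 opprK addrA cosDpihalf oppr_le0.
  by rewrite sin_ge0_pi//; apply/andP; split; lra.
rewrite dot_geo_points// leNgt => /negP; apply.
rewrite -cosN cos_gt0_pihalf//; apply/andP; split; lra.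
Qed.

Let circumradius_body_ge : t <= circumradius p K.
Proof.
apply: lb_le_inf.
  exists pi; split; first exact: pi_ge0.
  by move=> y [Sy _]; split => //; have /andP[] := geo_dist_itv Sp Sy.
move=> r [r0 rK]; have [] := rK y0; last by rewrite dy0.
by apply: gens_body; right.
Qed.

(** If [z] lies outside both balls, all generators are closer to [p] than to [z] with a uniform gap.
    By [body_strict] the whole hull then lies strictly on one side of the hyperplane orthogonal to
    [z - p], which therefore misses it. *)
Lemma test_body : exists K, [/\ bodies_at p K, a <= inradius p K,
  t - a <= vartheta p K &
  (Utilde p K <= sigma (geo_ball p (2 * a) `|` geo_ball y0 t))%E].
Proof.
have [a0 at_ tpi] := atpi.
exists K; split => //.
- by apply: inradius_ge => // y ya; apply: gens_body; left.
- by rewrite /vartheta; have := circumradius_body_ge; have := inradius_body_le; lra.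
apply: Utilde_le; first by apply: measurableU; exact: measurable_geo_ball.
move=> z v Sz Kv zv; apply: contrapT => nz.
have pz : 2 * a < geo_dist p z.
  by rewrite ltNge; apply/negP => h; apply: nz; left.
have yz : t < geo_dist y0 z.
  by rewrite ltNge; apply/negP => h; apply: nz; right.
have /andP[_ pzpi] := geo_dist_itv Sp Sz.
have pza : 0 <= geo_dist p z - a <= pi by apply/andP; split; lra.
have e1 : 0 < cos a - cos (geo_dist p z - a).
  by rewrite subr_gt0 ltr_cos ?in_itv//; lra.
have e2 : 0 < cos t - dot y0 z by rewrite subr_gt0 -geo_dist_gt.
pose e := Num.min (cos a - cos (geo_dist p z - a)) (cos t - dot y0 z).
have e0 : 0 < e by rewrite lt_min e1 e2.
have : dot v (z - p) < 0.
  apply: (body_strict e0) Kv => u [[Su ua]|->].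
    apply: (@le_trans _ _ (- (cos a - cos (geo_dist p z - a)))); last first.
      by rewrite lerN2 ge_min lexx.
    have h1 : cos a <= dot u p by rewrite dotC -geo_dist_le.
    have h2 : dot u z <= cos (geo_dist p z - a).
      by rewrite -geo_dist_ge//; have := geo_dist_triangle Sp Su Sz; lra.
    by rewrite dotBr; lra.
  apply: (@le_trans _ _ (- (cos t - dot y0 z))); last first.
    by rewrite lerN2 ge_min lexx orbT.
  by rewrite dotBr (dotC y0 p) -(cos_geo_dist Sp Sy0) dy0; lra.
by rewrite dotC zv ltxx.
Qed.

End cap_and_point.
End test_body.

(** * A lower bound for the measure of a cap *)

Section trigonometric_bounds.
Variable R : realType.
Implicit Types x a b c k h : R.

Let sin_within a b : {within `[a, b], continuous (@sin R)}.
Proof. by apply: continuous_subspaceT => x; exact: continuous_sin. Qed.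

Lemma sin_le_id x : 0 <= x -> sin x <= x.
Proof.
rewrite le_eqVlt => /predU1P[<-|x0]; first by rewrite sin0.
have [c _] := MVT x0 (fun y _ => is_derive_sin y) (@sin_within 0 x).
rewrite sin0 !subr0 => ->; rewrite -[leRHS]mul1r ler_wpM2r ?cos_le1//; exact: ltW.
Qed.

(* Jordan's inequality: compare the slopes of [sin] over [0, x] and
   [x, pi / 2]. *)
Lemma sin_ge_chord x : 0 <= x <= pi / 2 -> 2 / pi * x <= sin x.
Proof.
have pi0 := pi_gt0 R.
move=> /andP[]; rewrite le_eqVlt => /predU1P[<-|x0]; first by rewrite sin0 mulr0.
rewrite le_eqVlt => /predU1P[->|xpi].
  have pi_neq0 : pi != 0 :> R by rewrite gt_eqF.
  have -> : 2 / pi * (pi / 2) = 1 :> R by move: (pi : R) pi_neq0 => q ?; field.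
  by rewrite sin_pihalf.
have [c1 + s1] := MVT x0 (fun y _ => is_derive_sin y) (@sin_within 0 x).
have [c2 + s2] := MVT xpi (fun y _ => is_derive_sin y) (@sin_within x (pi / 2)).
rewrite !in_itv/= => /andP[c2x c2pi] /andP[c10 c1x].
have c12 : cos c2 < cos c1.
  by rewrite ltr_cos ?in_itv/=; [lra|apply/andP; split; lra..].
move: s1 s2; rewrite sin0 sin_pihalf !subr0 => s1 s2.
have : x <= sin x * (pi / 2).
  have : (cos c1 - cos c2) * (pi / 2 - x) >= 0 by rewrite mulr_ge0; lra.
  move=> h; have h2 : 0 <= x * ((cos c1 - cos c2) * (pi / 2 - x)) by rewrite mulr_ge0// ltW.
  have h3 : x * (cos c2 * (pi / 2 - x)) = x * (1 - sin x) by rewrite s2.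
  have h4 : sin x * (pi / 2 - x) = cos c1 * x * (pi / 2 - x) by rewrite -s1.
  nra.
move=> h; rewrite mulrAC ler_pdivrMr//; lra.
Qed.

(* [pi / 12 >= sin (pi / 12)], which is evaluated through [cos (pi / 6)]. *)
Lemma pi_sqr_ge : 96 / 10 <= (pi : R) ^+ 2.
Proof.
have pi0 := pi_gt0 R.
pose c : R := cos (pi / 6); pose s : R := sin (pi / 12).
have c0 : 0 < c by apply: cos_gt0_pihalf; apply/andP; split; lra.
have c2 : c ^+ 2 = 3 / 4.
  have : cos (pi / 6 + pi / 6 *+ 2) = 0 :> R.
    by rewrite -(cos_pihalf R); congr cos; rewrite mulr2n; lra.
  rewrite cosD cos_mulr2n sin_mulr2n -/c.
  have := sin2cos2 (pi / 6 : R); rewrite -/c; move: (sin _) => u u2.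
  have -> : c * (c ^+ 2 *+ 2 - 1) - u * ((c * u) *+ 2) = c * (4 * c ^+ 2 - 3).
    transitivity (c * (c ^+ 2 *+ 2 - 1) - 2 * c * u ^+ 2); first by ring.
    by rewrite u2; ring.
  by move=> /eqP; rewrite mulf_eq0 gt_eqF//= => /eqP; lra.
have s2 : s ^+ 2 = (1 - c) / 2.
  have : c = cos (pi / 12 *+ 2) by rewrite /c; congr cos; rewrite mulr2n; lra.
  by rewrite cos_mulr2n cos2sin2 -/s => ->; rewrite mulr2n; lra.
have s0 : 0 <= s by apply: sin_ge0_pi; apply/andP; split; lra.
have sx : s <= pi / 12 by apply: sin_le_id; lra.
(* Just above the square root of 3/4; it gives [144 * s ^+ 2 >= 9.64]. *)
have c_le : c <= 8661 / 10000 by nra.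
nra.
Qed.

Lemma integral_FTC2 (F f : R -> R) a b : a < b ->
  (forall x, is_derive x 1 F (f x)) -> continuous f ->
  (\int[lebesgue_measure]_(x in `[a, b]) (f x)%:E = (F b - F a)%:E)%E.
Proof.
move=> ab dF cf.
have cF : continuous F.
  move=> x; apply/differentiable_continuous/derivable1_diffP.
  by have [] := dF x.
rewrite (@continuous_FTC2 _ f F)//.
- exact: continuous_subspaceT.
- split.
  + by move=> x _; have [] := dF x.
  + by apply: cvg_at_right_filter; exact: cF.
  + by apply: cvg_at_left_filter; exact: cF.
by move=> x _; rewrite derive1E; exact: derive_val.
Qed.

Lemma integral_affine_pow n k h a b : k != 0 -> a < b ->
  (\int[lebesgue_measure]_(x in `[a, b]) ((k * x + h) ^+ n)%:E =
   (((k * b + h) ^+ n.+1 - (k * a + h) ^+ n.+1) / (k * n.+1%:R))%:E)%E.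
Proof.
move=> k0 ab.
pose F : R -> R := (k * n.+1%:R)^-1 *: ((k *: (id : R -> R) + cst h) ^+ n.+1).
have n0 : n.+1%:R != 0 :> R by rewrite pnatr_eq0.
have FE x : F x = (k * x + h) ^+ n.+1 / (k * n.+1%:R).
  by rewrite /F !fctE; exact: mulrC.
have dF x : is_derive x 1 F ((k * x + h) ^+ n).
  rewrite /F; apply: is_derive_eq.
  rewrite /GRing.scale /= addr0 mulr1 !fctE /=.
  by field; rewrite k0 andbT nat1r.
rewrite (integral_FTC2 ab dF); first by rewrite !FE mulrBl.
rewrite (_ : (fun _ => _) = (k *: (id : R -> R) + cst h) ^+ n); last first.
  by apply/funext => x; rewrite !fctE.
by move=> x; apply/differentiable_continuous/derivable1_diffP; exact: ex_derive.
Qed.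

Lemma integral_one_sub_sqr :
  (\int[lebesgue_measure]_(x in `[(-1)%R, (1 : R)%R]) (1 - x ^+ 2)%:E = (4 / 3)%:E)%E.
Proof.
pose F : R -> R := (id : R -> R) - 3^-1 *: (id : R -> R) ^+ 3.
have FE x : F x = x - x ^+ 3 / 3.
  by rewrite /F !fctE; congr (_ - _); exact: mulrC.
have dF x : is_derive x 1 F (1 - x ^+ 2).
  rewrite /F; apply: is_derive_eq.
  by rewrite /GRing.scale /= ?fctE /=; field.
have lt11 : -1 < 1 :> R by rewrite -subr_gt0 opprK.
rewrite (integral_FTC2 lt11 dF); first by rewrite !FE; congr EFin; field.
rewrite (_ : (fun _ => _) = cst 1 - (id : R -> R) ^+ 2); last first.
  by apply/funext => x; rewrite !fctE.
by move=> x; apply/differentiable_continuous/derivable1_diffP; exact: ex_derive.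
Qed.

End trigonometric_bounds.

(** * Volumes of the unit ball and of its sectors *)

Section volumes.
Variables (R : realType) (d : nat).
Local Notation V := ('cV[R]_d.+1).
Local Notation leb := (@lebesgue_measure R).
Local Notation mu := (lebesgue_cV R d).
Local Notation sig A := (fine (sigma_circ R d A)).

Definition disc (s : R) : set 'cV[R]_d := [set y | sqn y <= s ^+ 2].

Lemma measurable_disc s : measurable (disc s).
Proof.
rewrite (_ : disc s = (@sqn R d : _ -> measurableTypeR R) @^-1` `]-oo, s ^+ 2]%classic).
  by apply: preimageT_measurable => //; exact: measurable_sqn.
by apply/seteqP; split => y; rewrite /disc /= in_itv.
Qed.

Let omega := fine (mu (disc 1)).

Let omegaE : mu (disc 1) = omega%:E.
Proof.
rewrite fineK// ge0_fin_numE//.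
apply: (@le_lt_trans _ _ (mu (box d (-2) 1))); last first.
  by rewrite lebesgue_cV_box ?ltry//; lra.
apply: le_measure; rewrite ?in_setE; [exact: measurable_disc|exact: measurable_box|].
move=> y; rewrite /disc /= expr1n => y1 i.
have : y i ord0 ^+ 2 <= 1.
  apply: le_trans y1; rewrite /sqn (bigD1 i)//= lerDl.
  by apply: sumr_ge0 => j _; exact: sqr_ge0.
by move=> ?; apply/andP; split; nra.
Qed.

Let omega_ge0 : 0 <= omega. Proof. exact: fine_ge0. Qed.

Lemma disc_measure s : 0 < s -> mu (disc s) = (s ^+ d * omega)%:E.
Proof.
move=> s0; rewrite -(lebesgue_cV_affine 0 s0 (measurable_disc s)) EFinM -omegaE.
congr (_ * mu _)%E; apply/seteqP; split => y; rewrite /disc /= addr0 expr1n.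
  have -> : sqn (s *: y) = s ^+ 2 * sqn y.
    by rewrite /sqn mulr_sumr; apply: eq_bigr => i _; rewrite mxE exprMn.
  by rewrite -[leRHS]mulr1 ler_pM2l// exprn_gt0.
have -> : sqn (s *: y) = s ^+ 2 * sqn y.
  by rewrite /sqn mulr_sumr; apply: eq_bigr => i _; rewrite mxE exprMn.
by move=> h; rewrite -[leRHS]mulr1 ler_pM2l// exprn_gt0.
Qed.

Lemma lebesgue_cV_slices (A : set V) :
  lebesgue_cV R d.+1 A =
  (\int[leb]_t mu (xsection (@cons_cV R d @^-1` A) t))%E.
Proof. by []. Qed.

(** The slice at height [t] lies in a disc of radius [s] with [s ^+ 2 = 1 - t ^+ 2]. As [s <= 1] and
    [2 <= d], the factor [s ^+ d] is at most [1 - t ^+ 2], whose integral is [4 / 3] in every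
    dimension. *)
Lemma punctured_ball_le : (2 <= d)%N ->
  (lebesgue_cV R d.+1 (@punctured_ball R d) <= (4 / 3 * omega)%:E)%E.
Proof.
move=> d2; rewrite lebesgue_cV_slices.
have mpb : measurable (@cons_cV R d @^-1` @punctured_ball R d).
  apply: preimageT_measurable; first exact: measurable_cons_cV.
  exact: measurable_punctured_ball.
pose g (t : measurableTypeR R) := ((1 - t ^+ 2) * omega)%:E.
have mg D : measurable_fun D g.
  apply/measurable_EFinP; apply: measurable_funM => //.
  by apply: measurable_funB => //; exact: measurable_funX.
have gD : (\int[leb]_(t in `[(-1)%R, 1%R]) g t = (4 / 3 * omega)%:E)%E.
  under eq_integral do rewrite /g EFinM.
  rewrite ge0_integralZr//.
  - by rewrite integral_one_sub_sqr.
  - apply/measurable_EFinP; apply: measurable_funB => //; exact: measurable_funX.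
  - by move=> t /=; rewrite in_itv/= lee_fin => /andP[? ?]; nra.
rewrite -gD [leRHS]integral_mkcond.
(* At these two heights the radius is 0, while [disc_measure] asks for a positive one. *)
apply: (integral_le_offnull (N := [set -1; 1] : set (measurableTypeR R))).
- by apply: measurableU; exact: measurable_set1.
- apply: countable_lebesgue_measure0; apply: finite_set_countable.
  exact: finite_set2.
- by apply/(measurable_restrictT _ _).1 => //; exact: mg.
- by [].
- move=> t; apply: erestrict_ge0 => {}t /=; rewrite in_itv/= => /andP[? ?].
  by rewrite lee_fin mulr_ge0//; nra.
move=> t /not_orP[/eqP tN1 /eqP t1]; rewrite patchE.
case: ifPn => [|tI].
  rewrite in_setE /= in_itv/= => /andP[t2 t3].
  have {}t2 : -1 < t by rewrite lt_def tN1.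
  have {}t3 : t < 1 by rewrite lt_neqAle t1.
  have t21 : 0 < 1 - t ^+ 2 by nra.
  pose s := Num.sqrt (1 - t ^+ 2).
  have s0 : 0 < s by rewrite sqrtr_gt0.
  have s2 : s ^+ 2 = 1 - t ^+ 2 by rewrite sqr_sqrtr// ltW.
  apply: (@le_trans _ _ (mu (disc s))).
    apply: le_measure; rewrite ?in_setE.
    - exact: measurable_xsection.
    - exact: measurable_disc.
    move=> y; rewrite /xsection /= in_setE /punctured_ball /disc /= dot_cons s2 /=.
    by move=> /andP[_ ?]; lra.
  rewrite disc_measure// lee_fin ler_wpM2r// -s2.
  rewrite -[leRHS]mulr1 -(subnKC d2) exprD ler_wpM2l ?sqr_ge0//.
  have t20 := sqr_ge0 t; have s1 : s <= 1 by nra.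
  by rewrite exprn_ile1// ltW.
rewrite (_ : xsection _ t = set0) ?measure0//.
apply/seteqP; split => y //; rewrite /xsection /= in_setE /punctured_ball /= dot_cons /=.
move=> /andP[_ h]; have y0 := sqn_ge0 y.
by move/negP: tI; apply; rewrite in_setE /= in_itv/=; apply/andP; split; nra.
Qed.

(* Over [0 < t <= cos r] the slice of the sector contains the disc of radius
   [t * tan r], and over [cos r < t < 1] the disc whose radius decreases
   linearly from [sin r] to 0. *)
Lemma sector_ge r : 0 < r <= pi / 2 ->
  ((sin r ^+ d / d.+1%:R * omega)%:E <=
   lebesgue_cV R d.+1 (@punctured_ball R d `&`
     @direction R d @^-1` geo_ball (pole R d) r))%E.
Proof.
move=> /andP[r0 rpi]; rewrite lebesgue_cV_slices.
have pi0 := pi_gt0 R.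
pose c := cos r; pose s := sin r.
have c0 : 0 <= c by apply: cos_ge0_pihalf; apply/andP; split; lra.
have c1 : c < 1 by rewrite /c -cos0 ltr_cos ?in_itv/= ?lexx ?pi_ge0//; apply/andP; split; lra.
have s0 : 0 < s by apply: sin_gt0_pi; apply/andP; split; lra.
have sc : s ^+ 2 = 1 - c ^+ 2 by rewrite sin2cos2.
pose A := @cons_cV R d @^-1` (@punctured_ball R d `&`
  @direction R d @^-1` geo_ball (pole R d) r).
rewrite -/A.
have mA : measurable A.
  apply: preimageT_measurable; first exact: measurable_cons_cV.
  apply: measurableI; first exact: measurable_punctured_ball.
  apply: (preimageT_measurable (@measurable_direction R d)).
  by apply: measurable_geo_ball; exact: sphere_pole.
have memA t y : 0 < t -> t ^+ 2 + sqn y <= 1 -> c ^+ 2 * (t ^+ 2 + sqn y) <= t ^+ 2 ->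
    A (t, y).
  move=> t0 ty1 cty.
  have t2 : 0 < t ^+ 2 by rewrite exprn_gt0.
  have y0 := sqn_ge0 y.
  have pbz : punctured_ball (@cons_cV R d (t, y)).
    by rewrite /punctured_ball /= dot_cons /=; apply/andP; split; lra.
  split => //; split; first exact: sphere_direction.
  rewrite geo_dist_le//; [|exact: sphere_pole|exact: sphere_direction|
    by apply/andP; split; lra].
  rewrite dot_pole /direction mxE cons_cV0 dot_cons /= -/c.
  set q := Num.sqrt _.
  have q0 : 0 < q by rewrite sqrtr_gt0; lra.
  have q2 : q ^+ 2 = t ^+ 2 + sqn y by rewrite sqr_sqrtr; lra.
  rewrite mulrC ler_pdivlMr//.
  have : (c * q) ^+ 2 <= t ^+ 2 by rewrite exprMn q2.
  by move: (c * q) => k ?; nra.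
have m_slice t : measurable (xsection A t) by exact: measurable_xsection.
have slice_ge t u : 0 < u -> (forall y, sqn y <= u ^+ 2 -> A (t, y)) ->
    ((u ^+ d * omega)%:E <= mu (xsection A t))%E.
  move=> u0 h; rewrite -disc_measure//; apply: le_measure; rewrite ?in_setE//.
    exact: measurable_disc.
  by move=> y; rewrite /xsection /= in_setE; exact: h.
pose phi (t : measurableTypeR R) := mu (xsection A t).
have mphi D : measurable_fun D phi.
  by apply: measurable_funTS; exact: measurable_fun_xsection.
have mpow k h D : measurable_fun D
    ((fun t : measurableTypeR R => ((k * t + h) ^+ d)%:E) : _ -> \bar R).
  apply/measurable_EFinP; apply: measurable_funX; apply: measurable_funTS.
  exact: (measurable_affine k h).
have mpow' k h D : measurable_fun D
    ((fun t : measurableTypeR R => ((k * t + h) ^+ d)%:E * omega%:E)%E : _ -> \bar R).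
  by under eq_fun do rewrite muleC; apply: measurable_funeM; exact: mpow.
have phi0 t : (0 <= phi t)%E by exact: measure_ge0.
rewrite -[leRHS]/(\int[leb]_t phi t)%E.
have sum_le : (\int[leb]_(t in `]0%R, c]) phi t + \int[leb]_(t in `]c, 1%R[) phi t <=
    \int[leb]_t phi t)%E.
  rewrite -ge0_integral_setU//.
  - apply: ge0_subset_integral => //; apply: measurableU; exact: measurable_itv.
  - apply/disj_setPLR => t /=; rewrite !in_itv/= => /andP[_ tc] /andP[ct _].
    by move: (lt_le_trans ct tc); rewrite ltxx.
apply: le_trans sum_le.
have sd0 : 0 <= s ^+ d by rewrite exprn_ge0// ltW.
(* The two parts are cones over the same disc of radius [s], with heights [c] and [1 - c]. *)
rewrite (_ : s ^+ d / d.+1%:R * omega =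
  c * (s ^+ d / d.+1%:R * omega) + (1 - c) * (s ^+ d / d.+1%:R * omega)); last by ring.
rewrite EFinD; apply: leeD.
  move: c0; rewrite le_eqVlt => /predU1P[<-|c0].
    by rewrite mul0r integral_ge0.
  pose k := s / c; have k0 : 0 < k by rewrite divr_gt0.
  have kc : k * c = s by rewrite /k; field; rewrite gt_eqF.
  apply: (@le_trans _ _ (\int[leb]_(t in `[0%R, c]) (((k * t + 0) ^+ d)%:E * omega%:E))%E).
    rewrite ge0_integralZr ?lee_fin//; last first.
      move=> t /=; rewrite in_itv/= => /andP[t0 _].
      by rewrite lee_fin exprn_ge0// addr0 mulr_ge0// ltW.
    rewrite integral_affine_pow ?gt_eqF// -EFinM lee_fin !addr0 mulr0 kc expr0n subr0.
    rewrite mulrA ler_wpM2r//.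
    rewrite (_ : c * (s ^+ d / d.+1%:R) = s ^+ d.+1 / (k * d.+1%:R))//.
    rewrite exprS /k; field.
    by rewrite nat1r pnatr_eq0 !gt_eqF.
  rewrite -integral_itv_obnd_cbnd; last exact: mpow'.
  apply: ge0_le_integral => //.
    by move=> t /=; rewrite in_itv/= addr0 => /andP[t0 _]; rewrite -EFinM lee_fin mulr_ge0// exprn_ge0// mulr_ge0// ltW.
  move=> t /=; rewrite in_itv/= addr0 => /andP[t0 tc].
  have u0 : 0 < k * t by rewrite mulr_gt0.
  apply: slice_ge => // y yu; apply: memA => //.
    apply: le_trans (_ : t ^+ 2 + (k * t) ^+ 2 <= 1); first by rewrite lerD2l.
    rewrite -(ler_pM2l (_ : 0 < c ^+ 2)) ?exprn_gt0// mulr1.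
    rewrite (_ : c ^+ 2 * _ = t ^+ 2 * (c ^+ 2 + (k * c) ^+ 2)); last by ring.
    rewrite kc sc addrC subrK mulr1; nra.
  apply: (@le_trans _ _ (c ^+ 2 * (t ^+ 2 + (k * t) ^+ 2))).
    by rewrite ler_wpM2l ?sqr_ge0// lerD2l.
  rewrite (_ : c ^+ 2 * _ = t ^+ 2 * (c ^+ 2 + (k * c) ^+ 2)); last by ring.
  by rewrite kc sc addrC subrK mulr1.
pose k := s / (1 - c); have k0 : 0 < k by rewrite divr_gt0// subr_gt0.
have kc : k * (1 - c) = s by rewrite /k divfK// gt_eqF// subr_gt0.
have affE t : - k * t + k = k * (1 - t) by ring.
apply: (@le_trans _ _ (\int[leb]_(t in `[c, 1%R]) (((- k * t + k) ^+ d)%:E * omega%:E))%E).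
  rewrite ge0_integralZr ?lee_fin//; last first.
    move=> t /=; rewrite in_itv/= => /andP[_ t1].
    by rewrite lee_fin affE exprn_ge0// mulr_ge0 ?subr_ge0// ltW.
  rewrite integral_affine_pow ?oppr_eq0 ?gt_eqF// -EFinM lee_fin !affE subrr mulr0 kc expr0n sub0r.
  rewrite mulrA ler_wpM2r//.
  rewrite (_ : (1 - c) * (s ^+ d / d.+1%:R) = - s ^+ d.+1 / (- k * d.+1%:R))//.
  rewrite exprS -kc; field.
  by rewrite nat1r pnatr_eq0 !gt_eqF.
rewrite integral_itv_bndoo; last exact: mpow'.
apply: ge0_le_integral => //.
  move=> t /=; rewrite in_itv/= affE => /andP[_ t1].
  by rewrite -EFinM lee_fin mulr_ge0// exprn_ge0// mulr_ge0 ?subr_ge0// ltW.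
move=> t /=; rewrite in_itv/= affE => /andP[ct t1].
have u0 : 0 < k * (1 - t) by rewrite mulr_gt0// subr_gt0.
apply: slice_ge => // y yu; apply: memA => //.
- lra.
- apply: le_trans (_ : t ^+ 2 + (k * (1 - t)) ^+ 2 <= 1); first by rewrite lerD2l.
  (* The rim point at height [t] divides the chord from [(1, 0)] to [(c, s)] in the ratio given by
     [v], so it lies in the unit ball by convexity. *)
  pose v := (1 - t) / (1 - c).
  have tv : t = 1 - v * (1 - c) by rewrite /v divfK ?gt_eqF ?subr_gt0//; lra.
  have v0 : 0 <= v by rewrite divr_ge0 ?subr_ge0 ?ltW.
  have v1 : v <= 1 by rewrite ler_pdivrMr ?subr_gt0//; lra.
  rewrite (_ : k * (1 - t) = s * v); last first.
    by rewrite -kc /v; field; rewrite subr_eq0 gt_eqF.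
  clearbody v; rewrite exprMn sc tv.
  rewrite [leLHS](_ : _ = 1 - 2 * (v * ((1 - c) * (1 - v)))); last by ring.
  by rewrite gerBl mulr_ge0// mulr_ge0// mulr_ge0 ?subr_ge0// ltW.
apply: (@le_trans _ _ (c ^+ 2 * t ^+ 2 + s ^+ 2 * t ^+ 2)); last first.
  by rewrite -mulrDl sc addrC subrK mul1r.
rewrite mulrDr lerD2l; apply: (@le_trans _ _ (c ^+ 2 * s ^+ 2)).
  rewrite ler_wpM2l ?sqr_ge0//; apply: le_trans yu _.
  rewrite ler_sqr ?nnegrE ?(ltW u0) ?(ltW s0)// -kc ler_wpM2l ?(ltW k0)//; lra.
by rewrite mulrC ler_wpM2l ?sqr_ge0// ler_sqr ?nnegrE//; lra.
Qed.

End volumes.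

(** * Explicit lower bounds for caps *)

Section cap_lower_bound.
Variables (R : realType) (d : nat).
Local Notation V := ('cV[R]_d.+1).
Local Notation sig A := (fine (sigma_circ R d A)).
Implicit Types (p x : V) (r : R).

Lemma sphereN p : sphere p -> sphere (- p).
Proof. by rewrite /sphere /= dotNl dotNr opprK. Qed.

Lemma sig_hemisphere p : sphere p -> 1 / 2 <= sig (geo_ball p (pi / 2)).
Proof.
move=> Sp; have SNp := sphereN Sp; have pi0 := pi_gt0 R.
have : 1 <= sig (geo_ball p (pi / 2) `|` geo_ball (- p) (pi / 2)).
  rewrite -[leLHS]/(fine 1%E) -(sigma_circ_sphere R d).
  apply: sig_le; first exact: measurable_sphere.
    by apply: measurableU; exact: measurable_geo_ball.
  move=> x Sx; have pi2 : 0 <= (pi : R) / 2 <= pi by apply/andP; split; lra.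
  have [xp|xp] := leP 0 (dot p x); [left|right]; split => //.
    by rewrite geo_dist_le// cos_pihalf.
  by rewrite geo_dist_le// cos_pihalf dotNl oppr_ge0 ltW.
have := sig_leU (measurable_geo_ball (pi / 2) Sp) (measurable_geo_ball (pi / 2) SNp).
rewrite (sigma_circ_geo_ball _ SNp Sp); lra.
Qed.

(** The cap has the measure of its sector relative to the ball; the volume of the unit ball of one
    dimension less is common to both bounds and cancels. *)
Lemma sig_geo_ball_small p r : (2 <= d)%N -> sphere p -> 0 < r <= pi / 2 ->
  3 / 4 * (sin r ^+ d / d.+1%:R) <= sig (geo_ball p r).
Proof.
move=> d2 Sp rpi; rewrite (sigma_circ_geo_ball _ Sp (sphere_pole R d)) sigma_circE.
have := sector_ge d rpi; have := punctured_ball_le R d2.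
set om := fine (lebesgue_cV R d _); clearbody om.
set S := @punctured_ball R d `&` _; set B := @punctured_ball R d.
have := @punctured_ball_gt0 R d; have := @punctured_ball_fin R d; rewrite -/B.
have mS : measurable S.
  apply: measurableI; first exact: measurable_punctured_ball.
  apply: (preimageT_measurable (@measurable_direction R d)).
  by apply: measurable_geo_ball; exact: sphere_pole.
have : (lebesgue_cV R d.+1 S <= lebesgue_cV R d.+1 B)%E.
  apply: le_measure; rewrite ?in_setE//; last exact: subIsetl.
  exact: measurable_punctured_ball.
have : (0 <= lebesgue_cV R d.+1 S)%E by exact: measure_ge0.
move: (lebesgue_cV R d.+1 S) (lebesgue_cV R d.+1 B) => [s||] [m||]//=.
rewrite ?lee_fin ?lte_fin => s0 sm _ m0 m_le s_ge.
rewrite ler_pdivlMr//; apply: le_trans s_ge.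
have K0 : 0 <= sin r ^+ d / d.+1%:R.
  rewrite divr_ge0// exprn_ge0// sin_ge0_pi//.
  by have := pi_gt0 R; case/andP: rpi => ? ? ?; apply/andP; split; lra.
move: (sin r ^+ d / d.+1%:R) K0 => K K0; nra.
Qed.

(* The six spherical caps of angular radius [pi / 4] around the vectors
   [+- e_i], for three coordinates [i], have disjoint interiors. *)
Lemma sig_geo_ball_large p : (2 <= d)%N -> sphere p ->
  5 / 6 <= sig (geo_ball p (3 * pi / 4)).
Proof.
move=> d2 Sp; have pi0 := pi_gt0 R.
have r0 : 0 <= 3 * (pi : R) / 4 <= pi by apply/andP; split; lra.
pose k : R := cos (3 * pi / 4).
have k_lt0 : k < 0.
  rewrite /k (_ : 3 * pi / 4 = pi / 4 + pi / 2); last by lra.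
  rewrite cosDpihalf oppr_lt0 sin_gt0_pi//; apply/andP; split; lra.
have k2 : k ^+ 2 = 1 / 2.
  have : cos ((3 * pi / 4) *+ 2) = 0 :> R.
    rewrite (_ : _ *+ 2 = pi / 2 + pi); last by rewrite mulr2n; lra.
    by rewrite cosDpi cos_pihalf oppr0.
  by rewrite cos_mulr2n -/k; lra.
have lt_d (i : 'I_3) : (i < d.+1)%N by exact: leq_trans (ltn_ord i) _.
pose e (i : 'I_3 * bool) : V := (-1) ^+ i.2 *: delta_mx (Ordinal (lt_d i.1)) ord0.
have dot_e i x : dot (e i) x = (-1) ^+ i.2 * x (Ordinal (lt_d i.1)) ord0.
  rewrite dotZl; congr (_ * _); rewrite /dot (bigD1 (Ordinal (lt_d i.1)))//=.
  rewrite mxE !eqxx mul1r big1 ?addr0// => j /negbTE ji.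
  by rewrite mxE ji mul0r.
have Se i : sphere (e i).
  by rewrite /sphere /= dot_e !mxE !eqxx mulr1 -expr2 sqrr_sign.
pose D i : set V := sphere `\` geo_ball (e i) (3 * pi / 4).
have DP i x : D i x -> sphere x /\ dot (e i) x < k.
  move=> [Sx nx]; split => //; rewrite ltNge; apply/negP => h.
  by apply: nx; split => //; rewrite geo_dist_le.
have mD i : measurable (D i).
  by apply: measurableD; [exact: measurable_sphere|exact: measurable_geo_ball].
have D_disj i j x : D i x -> D j x -> i = j.
  move=> /DP[Sx xi] /DP[_ xj]; move: xi xj; rewrite !dot_e.
  case: i => i b; case: j => j b' /=.
  have [->|ij] := eqVneq i j.
    by case: b; case: b' => //=; rewrite ?expr0 ?expr1 => xi xj; exfalso; lra.
  set u := x _ _; set v := x _ _ => xi xj; exfalso.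
  have : u ^+ 2 + v ^+ 2 <= 1.
    rewrite -Sx /dot (bigD1 (Ordinal (lt_d i)))//= (bigD1 (Ordinal (lt_d j)))//=; last first.
      by rewrite -val_eqE /= eq_sym; apply: contra ij => /eqP/val_inj ->.
    rewrite -/u -/v -!expr2 addrA lerDl.
    by apply: sumr_ge0 => l _; rewrite -expr2 sqr_ge0.
  by move: xi xj; case: b; case: b' => /=; rewrite ?expr0 ?expr1; nra.
have sD i : 1 - sig (geo_ball p (3 * pi / 4)) <= sig (D i).
  have mB := measurable_geo_ball (3 * pi / 4) (Se i).
  rewrite (sigma_circ_geo_ball _ Sp (Se i)) lerBlDr.
  apply: le_trans (sig_leU (mD i) mB).
  rewrite -[leLHS]/(fine 1%E) -(sigma_circ_sphere R d).
  apply: sig_le; [exact: measurable_sphere|exact: measurableU|].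
  by move=> x Sx; have [|] := pselect (geo_ball (e i) (3 * pi / 4) x); [right|left].
have : \sum_i sig (D i) <= 1.
  rewrite -sig_bigcup//; apply: sig_le1.
  by apply: fin_bigcup_measurable => //; exact: finite_finset.
have : \sum_(i : 'I_3 * bool) (1 - sig (geo_ball p (3 * pi / 4))) <= \sum_i sig (D i).
  by apply: ler_sum => i _.
rewrite sumr_const card_prod card_ord card_bool -[X in X <= _ -> _]mulr_natr; lra.
Qed.

(** Up to [pi / 2] the sector bound and Jordan's inequality apply. Up to [3 * pi / 4] the left side
    is at most 1/2, the bound for a hemisphere. Beyond, it is at most [8 / pi ^+ 2], and [pi_sqr_ge]
    is exactly what makes this at most 5/6. *)
Lemma sig_geo_ball_ge p r : (2 <= d)%N -> sphere p -> 0 < r < pi ->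
  2 * (2 * r / pi ^+ 2) ^+ d <= sig (geo_ball p r).
Proof.
move=> d2 Sp /andP[r0 rpi].
have pi0 := pi_gt0 R; have pi2 := pi_sqr_ge R.
have pi3 : 3 <= pi :> R by nra.
pose q := 2 * r / pi ^+ 2.
have q0 : 0 < q by rewrite !mulr_gt0// invr_gt0 exprn_gt0.
have qE : q * pi ^+ 2 = 2 * r by rewrite divfK// expf_neq0// gt_eqF.
have q_mono u : q <= u -> u <= 1 -> q ^+ d <= u ^+ 2.
  move=> qu u1; have q1 : q <= 1 := le_trans qu u1.
  rewrite -(subnKC d2) exprD; apply: (@le_trans _ _ (q ^+ 2)).
    rewrite -[leRHS]mulr1 ler_wpM2l ?sqr_ge0// exprn_ile1//; exact: ltW.
  by rewrite ler_sqr ?nnegrE ?(le_trans (ltW q0))// ltW.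
rewrite -/q; have [r_le|r_gt] := leP r (pi / 2).
  have rr : 0 < r <= pi / 2 by rewrite r0.
  apply: le_trans (sig_geo_ball_small d2 Sp rr).
  have sr : 2 / pi * r <= sin r by apply: sin_ge_chord; rewrite ltW.
  have qs : q * pi <= sin r.
    apply: le_trans sr; rewrite (_ : 2 / pi * r = q * pi)//.
    have pi_neq0 : pi != 0 :> R by rewrite gt_eqF.
    by rewrite /q; move: (pi : R) pi_neq0 => t ?; field.
  apply: (@le_trans _ _ (3 / 4 * ((q * pi) ^+ d / d.+1%:R))); last first.
    have qp0 : 0 <= q * pi by rewrite mulr_ge0 ?ltW.
    rewrite ler_wpM2l// ler_wpM2r ?invr_ge0//.
    by apply: lerXn2r => //; rewrite nnegrE// (le_trans qp0).
  have comm3 (x y z : R) : 3 / 4 * (x * y / z) = x * (3 / 4 * y / z) by ring.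
  rewrite [(q * pi) ^+ d]exprMn comm3.
  rewrite mulrC ler_wpM2l ?exprn_ge0 ?(ltW q0)// ler_pdivlMr ?ltr0n//.
  have : 8 * d.+1%:R <= 3 * pi ^+ d :> R.
    rewrite -(subnKC d2); elim: (d - 2)%N => [|n IH]; first by rewrite addn0; lra.
    rewrite addnS exprS -[X in 8 * X]natr1; move: IH.
    have : 1 <= (2 + n).+1%:R :> R by rewrite ler1n.
    by move: ((2 + n).+1%:R : R) (pi ^+ (2 + n) : R) => N Pn; nra.
  lra.
have [r_le|r_gt2] := leP r (3 * pi / 4).
  have q_half : q <= 1 / 2 by nra.
  apply: (@le_trans _ _ (2 * (1 / 2) ^+ 2)).
    by rewrite ler_wpM2l// q_mono//; lra.
  apply: le_trans (_ : sig (geo_ball p (pi / 2)) <= _).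
    by have := sig_hemisphere Sp; lra.
  apply: sig_le; [exact: measurable_geo_ball..|apply: geo_ball_subW; exact: ltW].
have qp : q * pi <= 2.
  by rewrite -(ler_pM2r pi0) -mulrA -expr2 qE; lra.
have q_pi : q <= 2 / pi by rewrite ler_pdivlMr.
apply: (@le_trans _ _ (2 * (2 / pi) ^+ 2)).
  rewrite ler_wpM2l// q_mono// ler_pdivrMr//; lra.
apply: le_trans (_ : sig (geo_ball p (3 * pi / 4)) <= _).
  apply: le_trans (sig_geo_ball_large d2 Sp).
  rewrite expr_div_n mulrA ler_pdivrMr ?exprn_gt0//; lra.
apply: sig_le; [exact: measurable_geo_ball..|apply: geo_ball_subW; exact: ltW].
Qed.

End cap_lower_bound.

(** * Assembling the estimates *)

Section auxiliary.
Variables (R : realType) (d : nat).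
Local Notation V := ('cV[R]_d.+1).

(** The first two coordinates of [p] cannot both have square 1, so one of the first two basis
    vectors is not parallel to [p] and gives a direction to move in. *)
Lemma exists_geo_dist (p : V) (t : R) : (0 < d)%N -> sphere p -> 0 <= t <= pi ->
  exists y, sphere y /\ geo_dist p y = t.
Proof.
move=> d0 Sp tpi.
suff [z [Sz z1]] : exists z : V, sphere z /\ -1 < dot p z < 1.
  have pz : 0 < geo_dist p z < pi.
    have /andP[z_gt z_lt] := z1.
    rewrite geo_dist_gt ?geo_dist_lt ?lexx ?pi_ge0 ?cos0 ?cospi//.
    by rewrite z_gt z_lt.
  exists (geo_point p z t); split; first exact: sphere_geo_point.
  exact: geo_dist_geo_point_l.
pose e (i : 'I_d.+1) : V := delta_mx i ord0.
have dot_e i x : dot x (e i) = x i ord0.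
  rewrite dotC /dot (bigD1 i)//= mxE !eqxx mul1r big1 ?addr0// => j /negbTE ji.
  by rewrite mxE ji mul0r.
have Se i : sphere (e i) by rewrite /sphere /= dot_e mxE !eqxx.
pose i1 : 'I_d.+1 := Ordinal (d0 : (1 < d.+1)%N).
have : p ord0 ord0 ^+ 2 + p i1 ord0 ^+ 2 <= 1.
  rewrite -Sp /dot (bigD1 ord0)//= (bigD1 i1)//= -!expr2 addrA lerDl.
  by apply: sumr_ge0 => j _; rewrite -expr2 sqr_ge0.
have [p0 _|p0 h] := ltP (p ord0 ord0 ^+ 2) 1.
  by exists (e ord0); split => //; rewrite dot_e; apply/andP; split; nra.
by exists (e i1); split => //; rewrite dot_e; apply/andP; split; nra.
Qed.

Lemma typical_cell_prob0 (dO : measure_display) (Om : measurableType dO)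
    (P : probability Om R) (X : Om -> set V) (gamma : R)
    (kappa : R.-pker V ~> 'M[R]_d.+1) :
  typical_cell_prob P X gamma kappa set0 = 0%E.
Proof.
rewrite /typical_cell_prob integral0_eq ?mule0// => w _.
rewrite fsbig1// => x _; rewrite integral0_eq// => phi _.
by rewrite indicE memNset.
Qed.

Lemma exists_powR_ge (x e k : R) : 0 < x -> 0 < e -> 0 < k < 1 ->
  exists2 y, 0 < y < x & y `^ e = k * x `^ e.
Proof.
move=> x0 e0 /andP[k0 k1]; pose u := k `^ e^-1.
have u0 : 0 < u by exact: powR_gt0.
have ue : u `^ e = k by rewrite -powRrM mulVf ?gt_eqF// powRr1// ltW.
have u1 : u < 1.
  rewrite ltNge; apply/negP => u1; move: k1; rewrite -ue ltNge => /negP; apply.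
  have : 1 `^ e <= u `^ e by rewrite ge0_ler_powR ?nnegrE// ltW.
  by rewrite powR1.
exists (u * x); first by rewrite mulr_gt0//= gtr_pMl.
by rewrite powRM ?ltW// ue.
Qed.

Lemma fine_le_EFin (x : \bar R) (y : R) : 0 <= y -> (x <= y%:E)%E -> fine x <= y.
Proof. by case: x => [x||]//= _; rewrite leye_eq. Qed.

End auxiliary.

Theorem theorem10p2 (R : realType) (d : nat) (p : 'cV[R]_d.+1) (a eps c : R) :
  (2 <= d)%N -> sphere p -> 0 < a < pi / 2 -> 0 < eps <= 1 ->
  (2 * pi) ^- (2 * d) * a^-1 * (Num.min a (pi / 2 - a)) ^+ d.-1 <= c ->
  (forall (t : R) (K : set 'cV[R]_d.+1), 0 < t <= 1 -> bodies_at p K ->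
     a <= inradius p K -> t <= vartheta p K ->
     ((1 + c * t `^ (d.+1%:R / 2))%:E * Utilde p (geo_ball p a)
        <= Utilde p K)%E) ->
  let rho : R := fine (sigma_circ R d (geo_ball p (2 * a))) in
  let event_r := [set K : set 'cV[R]_d.+1 | a <= inradius p K] in
  let event_theta :=
    [set K : set 'cV[R]_d.+1 | bodies_at p K /\ eps <= vartheta p K] in
  (exists c12 c13 : R,
    [/\ 0 < c12,
        2^-1 * c * rho <= c13,
        pi ^- (4 * d) * a ^+ d.-1 * (Num.min a (pi / 2 - a)) ^+ d.-1
          <= 2^-1 * c * rho &
        forall (gamma : R) (Q : set (set 'cV[R]_d.+1) -> \bar R),
          0 < gamma -> typical_cell_law p gamma Q ->
          cond_prob Q event_theta event_r
            <= c12 * expR (- (c13 * eps `^ (d.+1%:R / 2) * gamma))]) /\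
  (forall Q : R -> set (set 'cV[R]_d.+1) -> \bar R,
     (forall gamma, 0 < gamma -> typical_cell_law p gamma (Q gamma)) ->
     gamma^-1 * ln (fine (Q gamma event_r)) @[gamma --> +oo] --> - rho).
Proof.
move=> d2 Sp api epsi c_ge stab rho event_r event_theta.
have [a0 api2] := andP api; have [eps0 _] := andP epsi.
have pi0 := pi_gt0 R.
have d0 : (0 < d)%N by exact: leq_trans d2.
pose m := Num.min a (pi / 2 - a) ^+ d.-1.
have m0 : 0 < m by rewrite exprn_gt0// lt_min a0 subr_gt0.
have rho_ge : 2 * (2 * (2 * a) / pi ^+ 2) ^+ d <= rho.
  by apply: sig_geo_ball_ge => //; apply/andP; split; lra.
have c_lb0 : 0 < (2 * pi) ^- (2 * d) * a^-1 * m.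
  by rewrite !mulr_gt0 ?invr_gt0// exprn_gt0// mulr_gt0.
have c0 : 0 < c := lt_le_trans c_lb0 c_ge.
have rho_lb0 : 0 < 2 * (2 * (2 * a) / pi ^+ 2) ^+ d.
  by rewrite mulr_gt0// exprn_gt0// divr_gt0 ?exprn_gt0 ?mulr_gt0.
have rho0 : 0 < rho := lt_le_trans rho_lb0 rho_ge.
have rho_prob gamma Q : 0 < gamma -> typical_cell_law p gamma Q ->
  Q event_r = (expR (- (gamma * rho)))%:E by exact: prob_inradius.
split; last first.
  (* By the exact formula for the probability, the function is constant for positive [gamma]. *)
  move=> Q QP; apply: cvg_near_cst; near=> gamma.
  have gamma0 : 0 < gamma by near: gamma; exact: nbhs_pinfty_gt.
  rewrite (rho_prob _ _ gamma0 (QP _ gamma0)) /= expRK mulrN mulKf//.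
  by rewrite gt_eqF.
pose e : R := d.+1%:R / 2; have e0 : 0 < e by rewrite divr_gt0.
pose kap := c * eps `^ e.
have kap0 : 0 < kap by rewrite mulr_gt0// powR_gt0.
suff [C C0 HC] : exists2 C : R, 0 < C & forall gamma Q, 0 < gamma ->
    typical_cell_law p gamma Q ->
    (Q (event_theta `&` event_r) <=
      (C * expR (- (gamma * ((1 + kap / 2) * rho))))%:E)%E.
  exists C, (2^-1 * c * rho); split => //.
    (* The lower bounds on [c] and [rho] multiply to exactly the stated constant. *)
    rewrite (_ : pi ^- (4 * d) * a ^+ d.-1 * _ =
      2^-1 * ((2 * pi) ^- (2 * d) * a^-1 * m) *
      (2 * (2 * (2 * a) / pi ^+ 2) ^+ d)).
      apply: ler_pM => //; [|exact: ltW|].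
        by apply: mulr_ge0 => //; exact: ltW.
      exact: ler_wpM2l.
    rewrite -/m.
    have -> : 2 * (2 * a) = 4 * a by ring.
    rewrite !exprMn exprVn -!exprM.
    rewrite (_ : (2 : R) ^+ (2 * d) = 4 ^+ d); last first.
      by rewrite exprM; congr (_ ^+ d); ring.
    rewrite (_ : (4 * d = 2 * d + 2 * d)%N); last by rewrite -mulnDl.
    rewrite exprD -[in a ^+ d](prednK d0) exprS.
    have : (4 : R) ^+ d != 0 by rewrite expf_neq0.
    have : (pi : R) ^+ (2 * d) != 0 by rewrite expf_neq0// gt_eqF.
    have : a != 0 by rewrite gt_eqF.
    move: ((4 : R) ^+ d) ((pi : R) ^+ (2 * d)) (a ^+ d.-1) => x y z a_neq0 y0 x0.
    by field; rewrite ?a_neq0 ?x0 ?y0.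
  move=> gamma Q gamma0 QP; rewrite /cond_prob (rho_prob _ _ gamma0 QP) /=.
  rewrite ler_pdivrMr ?expR_gt0// -[leRHS]mulrA -expRD.
  apply: fine_le_EFin; first by rewrite mulr_ge0 ?expR_ge0 ?ltW.
  rewrite (_ : _ + _ = - (gamma * ((1 + kap / 2) * rho))); first exact: HC.
  by rewrite /kap -/e; field.
(* If [a + eps] exceeds [pi / 2] the joint event is empty, because a body at [p] has circumradius at
   most [pi / 2]. *)
have [api_eps|api_eps] := ltP (pi / 2) (a + eps).
  exists 1 => // gamma Q gamma0 [dO [Om [P [X [kappa [_ _ ->]]]]]].
  rewrite (_ : _ `&` _ = set0) ?typical_cell_prob0 ?lee_fin ?mul1r ?expR_ge0//.
  apply/seteqP; split => // K [[[_ _ Kpi] K_eps] Ka]; move: K_eps Ka.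
  have : circumradius p K <= pi / 2 by apply: circumradius_le => //; lra.
  rewrite /event_r /vartheta /=.
  by move: (circumradius p K) (inradius p K) => u v; lra.
(* Passing to a smaller [eps'] keeps 3/4 of the gain [kap * rho], and [eta] takes another quarter;
   one half remains. *)
have k34 : 0 < (3 / 4 : R) < 1 by apply/andP; split; lra.
have [eps' /andP[eps'0 eps'_lt] eps'E] := exists_powR_ge eps0 e0 k34.
pose t := a + eps'.
have t_pi : 0 <= t <= pi by rewrite /t; apply/andP; split; lra.
have [y0 [Sy0 dy0]] := exists_geo_dist d0 Sp t_pi.
have att : [/\ 0 < a, a < t & t < pi / 2] by rewrite /t; split; lra.
have [K [bK aK tK UK]] := test_body Sp Sy0 att dy0.
have mU : measurable (geo_ball p (2 * a) `|` geo_ball y0 t).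
  by apply: measurableU; exact: measurable_geo_ball.
have U_ge : (1 + 3 / 4 * kap) * rho <=
    fine (sigma_circ R d (geo_ball p (2 * a) `|` geo_ball y0 t)).
  rewrite -lee_fin sigEFin//; apply: le_trans UK.
  have eps'1 : 0 < eps' <= 1.
    by case/andP: epsi => ? ?; apply/andP; split; lra.
  have tK' : eps' <= vartheta p K by rewrite /t addrAC subrr add0r in tK.
  apply: le_trans (stab eps' K eps'1 bK aK tK').
  rewrite -/e eps'E EFinM (_ : c * _ = 3 / 4 * kap); last by rewrite /kap; ring.
  apply: lee_wpmul2l; first by rewrite lee_fin; lra.
  rewrite sigEFin; first exact: Utilde_geo_ball.
  exact: measurable_geo_ball.
have t_pi2 : 0 < t < pi / 2 by rewrite /t; apply/andP; split; lra.
have t_lt : t < a + eps by rewrite /t ltrD2l.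
have eta0 : 0 < kap * rho / 4 by rewrite divr_gt0// mulr_gt0.
have [C C0 HC] := prob_theta_bound Sp Sy0 api t_pi2 t_lt dy0 eta0.
exists C => // gamma Q gamma0 QP; apply: le_trans (HC gamma Q gamma0 QP) _.
rewrite lee_fin ler_pM2l// ler_expR lerN2 ler_pM2l//.
by move: U_ge; move: (fine _) => u; lra.
Unshelve. all: by end_near. Qed.
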